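(* Let $d \in \mathbb{N}$, $\alpha > -1$, $n \in \mathbb{N}_0$ and $p_n \in \mathcal{V}^{\alpha,1}_n$. Then, $$\tilde{\mathcal{L}}^{(\alpha)}(p_n) = \tilde\lambda^{(\alpha,1)}_n \, p_n, \quad\text{where}\quad \tilde\lambda^{(\alpha,1)}_n = n(n+d+2\alpha-2).$$
   Context: $\mathbb{N}$ is the set of positive integers and $\mathbb{N}_0=\mathbb{N}\cup\{0\}$. $B^d$ is the open unit ball of $\mathbb{R}^d$ and functions are complex-valued. For $\alpha>-1$, $\langle u,v\rangle_\alpha=\int_{B^d}u\,\overline{v}\,(1-\lVert x\rVert^2)^\alpha\,dx$ (also for vector-valued functions, summing over components). $\Pi^d_n$ is the space of $d$-variate polynomials of total degree at most $n$, with $\Pi^d_n=\{0\}$ for $n<0$. Let $\langle u,v\rangle_{\alpha,1}=\langle\nabla u,\nabla v\rangle_\alpha+c_\alpha^{-1}\langle u,1\rangle_\alpha\overline{\langle v,1\rangle_\alpha}$ with $c_\alpha=\langle1,1\rangle_\alpha$, and $\mathcal{V}^{\alpha,1}_n=\{p\in\Pi^d_n: \langle p,q\rangle_{\alpha,1}=0\ \forall q\in\Pi^d_{n-1}\}$. For $\beta\in\mathbb{R}$, let $d^\beta_jq(x)=-(1-\lVert x\rVert^2)\partial_jq(x)+2(\beta+1)x_jq(x)$, $D_{i,j}=x_i\partial_j-x_j\partial_i$, and $\mathcal{L}^{(\beta)}(q)=\sum_{j=1}^d d^\beta_j\partial_jq-\sum_{1\le i<j\le d}D_{i,j}^2q$.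 Finally, $\tilde{\mathcal{L}}^{(\alpha)}(q)=\mathcal{L}^{(\alpha-1)}(q)+2\,\mathrm{proj}^\alpha_0(x\cdot\nabla q)$, where $\mathrm{proj}^\alpha_0(f)=c_\alpha^{-1}\langle f,1\rangle_\alpha$ (a constant function) is the orthogonal projection of $f$ onto constants with respect to $\langle\cdot,\cdot\rangle_\alpha$. *)

(* Defs.v *)
From HB Require Import structures.
From mathcomp Require Import all_boot all_order all_algebra.
(* mpoly has to be imported before mathcomp-analysis: the other order fails
   on clashing notation levels. *)
From mathcomp Require Import complex mpoly.
From mathcomp Require Import all_classical all_reals all_analysis.

Set Implicit Arguments.
Unset Strict Implicit.
Unset Printing Implicit Defensive.
Import Order.TTheory GRing.Theory Num.Theory.
Local Open Scope classical_set_scope.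
Local Open Scope ring_scope.
Local Open Scope complex_scope.

(* Lebesgue measure on R^n, where R^n is n.-tuple R with its product
   sigma-algebra: the unit mass for n = 0, then the image of the product
   measure under (x, t) |-> x :: t. *)
Section lebesgue_tuple.
Variable R : realType.

Definition tuple_cons n (xt : R * n.-tuple R) : n.+1.-tuple R :=
  [tuple of xt.1 :: xt.2].

Definition tuple_uncons n (t : n.+1.-tuple R) : R * n.-tuple R :=
  (thead t, [tuple of behead t]).

Lemma tuple_consK n : cancel (@tuple_cons n) (@tuple_uncons n).
Proof.
by move=> [x t]; rewrite /tuple_uncons /tuple_cons /= theadE; congr pair;
  apply: val_inj.
Qed.

Lemma measurable_tuple_cons n : measurable_fun setT (@tuple_cons n).
Proof. exact: (measurable_cons measurable_fst measurable_snd). Qed.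

Lemma measurable_tuple_uncons n : measurable_fun setT (@tuple_uncons n).
Proof.
apply/measurable_fun_pairP; split; first exact: measurable_tnth.
exact: measurable_behead.
Qed.

Section step.
Variables (n : nat) (mu : {sigma_finite_measure set (n.-tuple R) -> \bar R}).

Definition lebesgue_step : set (n.+1.-tuple R) -> \bar R :=
  pushforward (lebesgue_measure \x mu)%E (@tuple_cons n).

Let mcons (A : set (n.+1.-tuple R)) : measurable A ->
  measurable (@tuple_cons n @^-1` A).
Proof.
by move=> mA; rewrite -[X in measurable X]setTI; exact: measurable_tuple_cons.
Qed.

Let lebesgue_step0 : lebesgue_step set0 = 0%E.
Proof. by rewrite /lebesgue_step /pushforward preimage_set0 measure0. Qed.

Let lebesgue_step_ge0 A : (0 <= lebesgue_step A)%E.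
Proof. exact: (measure_ge0 (lebesgue_measure \x mu)%E). Qed.

Let lebesgue_step_sigma_additive : semi_sigma_additive lebesgue_step.
Proof.
move=> F mF tF mUF; rewrite /lebesgue_step /pushforward preimage_bigcup.
apply: measure_semi_sigma_additive.
- by move=> k; exact: mcons.
- apply/trivIsetP => /= i j _ _ ij; rewrite -preimage_setI.
  by move/trivIsetP : tF => /(_ _ _ _ _ ij) ->//; rewrite preimage_set0.
- by rewrite -preimage_bigcup; exact: mcons.
Qed.

HB.instance Definition _ := isMeasure.Build _ _ _ lebesgue_step
  lebesgue_step0 lebesgue_step_ge0 lebesgue_step_sigma_additive.

Let lebesgue_step_sigma_finite : sigma_finite setT lebesgue_step.
Proof.
have /sigma_finiteP[F [FT ndF Foo]] := sigma_finiteT (@lebesgue_measure R).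
have /sigma_finiteP[G [GT ndG Goo]] := sigma_finiteT mu.
exists (fun k => @tuple_uncons n @^-1` (F k `*` G k)).
  rewrite -preimage_bigcup -[LHS](preimage_setT (@tuple_uncons n)).
  congr (_ @^-1` _); rewrite -setXTT FT GT predeqE => -[x t]; split.
    move=> [/= [i _ Fx] [j _ Gt]]; exists (maxn i j) => //; split.
    - by move: x Fx; exact/subsetPset/ndF/leq_maxl.
    - by move: t Gt; exact/subsetPset/ndG/leq_maxr.
  by move=> [i _ []/= ? ?]; split; exists i.
move=> k; have [mF Fk] := Foo k; have [mG Gk] := Goo k; split.
  rewrite -[X in measurable X]setTI; apply: measurable_tuple_uncons => //.
  exact: measurableX.
rewrite /lebesgue_step /pushforward -comp_preimage.
rewrite (_ : _ \o _ = id) ?preimage_id; last exact/funext/tuple_consK.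
by rewrite product_measure1E// lte_mul_pinfty// ge0_fin_numE.
Qed.

HB.instance Definition _ := Measure_isSigmaFinite.Build _ _ _ lebesgue_step
  lebesgue_step_sigma_finite.

End step.

Fixpoint lebesgue_tuple n : {sigma_finite_measure set (n.-tuple R) -> \bar R} :=
  match n with
  | 0 => \d_([tuple] : 0.-tuple R)
  | m.+1 => lebesgue_step (lebesgue_tuple m)
  end.

(* Fixes the normalization: the volume of a measurable box is the product of
   the measures of its sides. *)
Lemma lebesgue_tuple_box n (A : 'I_n -> set R) :
  (forall i, measurable (A i)) ->
  lebesgue_tuple n [set t | forall i, A i (tnth t i)]
  = (\prod_(i < n) lebesgue_measure (A i))%E.
Proof.
elim: n A => [|n IHn] A mA.
  rewrite big_ord0 /= (_ : [set _ | _] = setT) ?diracT//.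
  by apply/seteqP; split=> // t _ [].
rewrite big_ord_recl -IHn//= /lebesgue_step /pushforward.
rewrite (_ : _ @^-1` _ =
    A ord0 `*` [set t | forall i, A (lift ord0 i) (tnth t i)]); last first.
  apply/seteqP; split=> -[x t] /=.
    move=> H; split; first by have := H ord0; rewrite tnth0.
    by move=> i; have := H (lift ord0 i); rewrite tnthS.
  move=> [H0 H1] i; have [j ->|->] := unliftP ord0 i.
    by rewrite tnthS.
  by rewrite tnth0.
have mB : measurable [set t : n.-tuple R | forall i, A (lift ord0 i) (tnth t i)].
  rewrite [X in measurable X](_ : _ = \bigcap_(i in [set: 'I_n])
    ((fun t : n.-tuple R => tnth t i) @^-1` A (lift ord0 i))).
    apply: fin_bigcap_measurable => // i _.
    by rewrite -[X in measurable X]setTI; exact: measurable_tnth.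
  by apply/seteqP; split=> t H i; [move=> _; exact: H|exact: (H i)].
by rewrite product_measure1E //; exact: (mA ord0).
Qed.

End lebesgue_tuple.

Section ball.
Variables (R : realType) (d : nat).
Implicit Types (u v : d.-tuple R -> R[i]) (p q : {mpoly R[i][d]}).

Definition sqnorm (x : d.-tuple R) : R := \sum_(i < d) tnth x i ^+ 2.

Definition unit_ball : set (d.-tuple R) := [set x | sqnorm x < 1].

Definition integral_ball (f : d.-tuple R -> R[i]) : R[i] :=
  (\int[lebesgue_tuple R d]_(x in unit_ball) complex.Re (f x)) +i*
  (\int[lebesgue_tuple R d]_(x in unit_ball) complex.Im (f x)).

Definition inner (alpha : R) u v : R[i] :=
  integral_ball (fun x => u x * (v x)^* * ((1 - sqnorm x) `^ alpha)%:C).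

(* Polynomials in d real variables with complex coefficients are elements of
   {mpoly R[i][d]}, differentiated formally; mpfun is the associated function
   on R^d. *)
Definition mpfun p (x : d.-tuple R) : R[i] := p.@[fun i => (tnth x i)%:C].

Definition innerp (alpha : R) p q : R[i] := inner alpha (mpfun p) (mpfun q).

Definition inner_grad (alpha : R) p q : R[i] :=
  \sum_(i < d) innerp alpha p^`M(i) q^`M(i).

Definition calpha (alpha : R) : R[i] := innerp alpha 1 1.

Definition inner1 (alpha : R) p q : R[i] :=
  inner_grad alpha p q
  + (calpha alpha)^-1 * innerp alpha p 1 * (innerp alpha q 1)^*.

(* Total degree at most n; msize is the total degree plus one, and 0 for the
   zero polynomial, so only 0 qualifies when n < 0. *)
Definition Pi_ (n : int) : set {mpoly R[i][d]} :=
  [set p | (msize p)%:Z <= n + 1].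

Definition V1 (alpha : R) (n : nat) : set {mpoly R[i][d]} :=
  [set p | Pi_ n%:Z p /\
           forall q, Pi_ (n%:Z - 1) q -> inner1 alpha p q = 0].

Definition sqnormX : {mpoly R[i][d]} := \sum_(i < d) 'X_i ^+ 2.

Definition dbeta (beta : R) (j : 'I_d) q : {mpoly R[i][d]} :=
  - (1 - sqnormX) * q^`M(j) + (2 * (beta + 1))%:C *: ('X_j * q).

Definition Dij (i j : 'I_d) q : {mpoly R[i][d]} :=
  'X_i * q^`M(j) - 'X_j * q^`M(i).

Definition Lop (beta : R) q : {mpoly R[i][d]} :=
  \sum_(j < d) dbeta beta j q^`M(j)
  - \sum_(i < d) \sum_(j < d | (i < j)%N) Dij i j (Dij i j q).

Definition proj0 (alpha : R) q : {mpoly R[i][d]} :=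
  ((calpha alpha)^-1 * innerp alpha q 1)%:MP.

Definition euler q : {mpoly R[i][d]} := \sum_(j < d) 'X_j * q^`M(j).

Definition Ltilde (alpha : R) q : {mpoly R[i][d]} :=
  Lop (alpha - 1) q + 2 *: proj0 alpha (euler q).

End ball.

Definition lambda_tilde (R : realType) (d : nat) (alpha : R) (n : nat) : R :=
  n%:R * (n%:R + d%:R + 2 * alpha - 2).

(* Main.v *)
Require Import Defs.
From HB Require Import structures.
From mathcomp Require Import all_boot all_order all_algebra.
From mathcomp Require Import complex mpoly.
From mathcomp Require Import all_classical all_reals all_analysis.
From mathcomp Require Import measurable_realfun ring lra.

(* Let I(p) be the integral of p over the ball against the weight
   (1 - |x|^2)^alpha.  The divergence theorem on the ball reads
     I((1 - |x|^2) d_j p) = 2 (alpha + 1) I(x_j p),                        (1)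
   and everything else follows from (1) by algebra.  Writing E for the Euler
   operator x . grad, (1) determines I(x_j p) from I(d_j p) on eigenvectors p
   of E, which makes I invariant under infinitesimal rotations; hence
   L^(alpha) is symmetric for <., .>_alpha.  From
     L^(beta) = - Laplacian + E^2 + (d + 2 beta) E
   one gets d_i L^(alpha-1) = (L^(alpha) + d + 2 alpha - 1) d_i, so the
   corrected operator is symmetric for <., .>_{alpha,1} (its values have mean
   0).  It also acts on leading forms of degree n as the scalar
   n (n + d + 2 alpha - 2), so its defect on V_n has degree < n and is
   orthogonal to all polynomials of degree < n, thus vanishes.

   (1) itself is proved on monomials by peeling off one coordinate at a time
   with Fubini's theorem, for balls of arbitrary radius; for alpha < 0 the
   weight is unbounded and the one-dimensional case is a limit over compact
   intervals. *)

Set Implicit Arguments.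
Unset Strict Implicit.
Unset Printing Implicit Defensive.
Import Order.TTheory GRing.Theory Num.Theory.
Import numFieldNormedType.Exports.
Local Open Scope ring_scope.

(** * The ball operator over an abstract functional satisfying (1) *)

Section ball_operator.
Variables (K : numClosedFieldType) (d : nat).
Implicit Types (p q u v f g : {mpoly K[d]}) (c k : K) (i j : 'I_d).

Definition sqX : {mpoly K[d]} := \sum_(i < d) 'X_i ^+ 2.
Definition eul q : {mpoly K[d]} := \sum_(j < d) 'X_j * q^`M(j).
Definition lap q : {mpoly K[d]} := \sum_(j < d) q^`M(j)^`M(j).
Definition rot i j q : {mpoly K[d]} := 'X_i * q^`M(j) - 'X_j * q^`M(i).

(* The paper's L^(beta), with k = 2 (beta + 1). *)
Definition ballop k q : {mpoly K[d]} :=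
  \sum_(j < d) (- (1 - sqX) * q^`M(j)^`M(j) + k *: ('X_j * q^`M(j)))
  - \sum_(i < d) \sum_(j < d | (i < j)%N) rot i j (rot i j q).

(** * Closed form of L^(beta) through the Laplacian and the Euler operator *)

Lemma mderivXU i j : ('X_i : {mpoly K[d]})^`M(j) = (i == j)%:R.
Proof.
rewrite mderivX mnm1E; case: eqP => [->|_]; last by rewrite scale0r.
rewrite scale1r (_ : (_ - _)%MM = 0%MM) ?mpolyX0//.
by apply/mnmP => k; rewrite mnmBE subnn mnm0E.
Qed.

(** The right-hand side is an expression in [(i, j)] plus its swap, so that a sum over [i < j] turns
    into a sum over ordered pairs of distinct indices. *)
Lemma rot_rot i j q : i != j -> rot i j (rot i j q)
  = ('X_i ^+ 2 * q^`M(j)^`M(j) - 'X_i * 'X_j * q^`M(i)^`M(j) - 'X_i * q^`M(i))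
  + ('X_j ^+ 2 * q^`M(i)^`M(i) - 'X_j * 'X_i * q^`M(j)^`M(i) - 'X_j * q^`M(j)).
Proof.
move=> ij; have ji : j != i by rewrite eq_sym.
rewrite /rot !mderivB !mderivM !mderivXU !eqxx (negPf ij) (negPf ji).
rewrite (mderiv_comm j i) /=; ring.
Qed.

Lemma eul_eul q :
  eul (eul q) = (\sum_(i < d) \sum_(j < d) 'X_i * 'X_j * q^`M(i)^`M(j)) + eul q.
Proof.
rewrite /eul -big_split /=; apply: eq_bigr => j _.
rewrite raddf_sum mulr_sumr /=.
transitivity (\sum_(i < d)
    ('X_j * 'X_i * q^`M(j)^`M(i) + (i == j)%:R * ('X_j * q^`M(i)))).
  by apply: eq_bigr => i _; rewrite mderivM mderivXU (mderiv_comm i j); ring.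
rewrite big_split /=; congr (_ + _).
by rewrite (bigD1 j)//= eqxx mul1r big1 ?addr0// => i /negPf ->; rewrite mul0r.
Qed.

Lemma sum_rot_rot q : \sum_(i < d) \sum_(j < d | (i < j)%N) rot i j (rot i j q)
  = sqX * lap q - eul (eul q) - (d%:R - 2) *: eul q.
Proof.
pose S i j := 'X_i ^+ 2 * q^`M(j)^`M(j) - 'X_i * 'X_j * q^`M(i)^`M(j) - 'X_i * q^`M(i).
have -> : \sum_(i < d) \sum_(j < d | (i < j)%N) rot i j (rot i j q)
    = \sum_(i < d) \sum_(j < d | (i < j)%N) (S i j + S j i).
  apply: eq_bigr => i _; apply: eq_bigr => j ij; apply: rot_rot.
  by rewrite -val_eqE /= ltn_eqF.
under eq_bigr do rewrite big_split.
rewrite big_split /= [X in _ + X](exchange_big_dep xpredT)//=.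
rewrite -big_split /=.
(* In [S i i] the second derivatives cancel and only -x_i d_i q remains, so completing the inner
   sums to all [j] costs one [eul q]. *)
have -> : \sum_(i < d) (\sum_(j < d | (i < j)%N) S i j + \sum_(j < d | (j < i)%N) S i j)
    = \sum_(i < d) (\sum_(j < d) S i j + 'X_i * q^`M(i)).
  apply: eq_bigr => i _; rewrite (bigID (fun j : 'I_d => (i < j)%N) xpredT) /= -addrA.
  congr (_ + _); rewrite [in RHS](bigD1 i) ?ltnn//=.
  rewrite [LHS](_ : _ = \sum_(j < d | ~~ (i < j)%N && (j != i)) S i j); last first.
    by apply: eq_bigl => j; rewrite -leqNgt ltn_neqAle andbC.
  by rewrite /S; ring.
rewrite big_split /= -/(eul q) eul_eul /sqX /lap mulr_suml.
under [X in _ = X - _ - _]eq_bigr do rewrite mulr_sumr.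
(* Of the two copies of [eul q] split off here, one answers to [eul_eul] and one to the diagonal. *)
have -> : (d%:R - 2) *: eul q = \sum_(i < d) \sum_(j < d) 'X_i * q^`M(i) - eul q - eul q.
  have -> : \sum_(i < d) \sum_(j < d) 'X_i * q^`M(i) = eul q *+ d.
    by rewrite /eul -sumrMnl; apply: eq_bigr => i _; rewrite sumr_const card_ord.
  by rewrite scalerBl scaler_nat [2]/(1 + 1) scalerDl scale1r opprD addrA.
rewrite /S.
under eq_bigr do rewrite !(big_split, sumrN) /=.
rewrite !(big_split, sumrN) /=.
ring.
Qed.

(** The terms [sqX * lap q] of the radial and the rotational sum cancel. *)
Lemma ballopE k q : ballop k q = - lap q + eul (eul q) + (d%:R + k - 2) *: eul q.
Proof.
rewrite /ballop sum_rot_rot big_split /= -mulr_sumr -/(lap q) -scaler_sumr -/(eul q).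
rewrite !scalerBl !scalerDl; ring.
Qed.

Lemma eul_lin c p q : eul (c *: p + q) = c *: eul p + eul q.
Proof.
rewrite /eul scaler_sumr -big_split; apply: eq_bigr => i _ /=.
by rewrite mderivD mderivZ mulrDr scalerAr.
Qed.

Lemma lap_lin c p q : lap (c *: p + q) = c *: lap p + lap q.
Proof.
rewrite /lap scaler_sumr -big_split; apply: eq_bigr => i _ /=.
by rewrite !mderivD !mderivZ.
Qed.

Lemma ballop_lin k c p q : ballop k (c *: p + q) = c *: ballop k p + ballop k q.
Proof.
rewrite !ballopE !eul_lin lap_lin !scalerDr !scalerN !scalerA (mulrC c).
rewrite -!mul_mpolyC; ring.
Qed.

Lemma mderiv_eul i q : (eul q)^`M(i) = eul q^`M(i) + q^`M(i).
Proof.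
rewrite /eul raddf_sum /= addrC (bigD1 i)//= [in RHS](bigD1 i)//=.
rewrite mderivM mderivXU eqxx mul1r -addrA; congr (_ + (_ + _)).
apply: eq_bigr => j ji; rewrite mderivM mderivXU (negPf ji) mul0r add0r.
by rewrite mderiv_comm.
Qed.

Lemma mderiv_lap i q : (lap q)^`M(i) = lap q^`M(i).
Proof.
rewrite /lap raddf_sum; apply: eq_bigr => j _ /=.
by rewrite mderiv_comm (mderiv_comm j i).
Qed.

Lemma eulD p q : eul (p + q) = eul p + eul q.
Proof. by rewrite -[p]scale1r eul_lin !scale1r. Qed.

(** Since d_i commutes with [lap] and d_i E = (E + 1) d_i, expanding E^2 + (d + k - 2) E at E + 1
    yields both the shift of [k] by 2, which is beta to beta + 1, and the scalar. *)
Lemma mderiv_ballop k i q :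
  (ballop k q)^`M(i) = ballop (k + 2) q^`M(i) + (d%:R + k - 1) *: q^`M(i).
Proof.
rewrite !ballopE !mderivD mderivN mderivZ mderiv_lap !mderiv_eul eulD.
rewrite -!mul_mpolyC !(mpolyCD, mpolyCN, mpolyCB); ring.
Qed.

(** * Reduction to monomials and degree bounds *)

Lemma mpoly_lin_ind (P : {mpoly K[d]} -> Prop) :
  P 0 -> (forall c m p, P p -> P (c *: 'X_[m] + p)) -> forall p, P p.
Proof.
move=> P0 PS p; rewrite (mpolyE p); elim: (msupp p) => [|m r IHr].
  by rewrite big_nil.
by rewrite big_cons; exact: PS.
Qed.

Lemma eulX (m : 'X_{1..d}) : eul 'X_[m] = (mdeg m)%:R *: 'X_[m].
Proof.
rewrite /eul mdegE natr_sum scaler_suml; apply: eq_bigr => i _.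
rewrite mderivX; have [->|mi] := eqVneq (m i) 0%N; first by rewrite !scale0r mulr0.
by rewrite -scalerAr -mpolyXD addmC submK// lep1mP.
Qed.

Lemma msize_lin_ind (n : nat) (T : {mpoly K[d]} -> {mpoly K[d]}) N p :
  (forall c p q, T (c *: p + q) = c *: T p + T q) ->
  (forall m : 'X_{1..d}, (mdeg m < n)%N -> (msize (T 'X_[m]) <= N)%N) ->
  (msize p <= n)%N -> (msize (T p) <= N)%N.
Proof.
move=> Tlin Tm pn.
have T0 : T 0 = 0.
  have /eqP := Tlin 1 0 0; rewrite !scale1r addr0.
  by rewrite -subr_eq subrr => /eqP.
rewrite (mpolyE p).
have : {in msupp p, forall m, (mdeg m < n)%N}.
  by move=> m /msize_mdeg_lt /leq_trans; apply.
elim: (msupp p) => [|m r IHr] rn; first by rewrite big_nil T0 msize0.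
rewrite big_cons Tlin (leq_trans (msizeD_le _ _))// geq_max IHr ?andbT; last first.
  by move=> m' m'r; rewrite rn// in_cons m'r orbT.
by rewrite (leq_trans (msizeZ_le _ _))// Tm// rn// mem_head.
Qed.

Lemma msize_mderivX i (m : 'X_{1..d}) : (msize ('X_[m]^`M(i) : {mpoly K[d]}) <= mdeg m)%N.
Proof.
rewrite mderivX; have [->|mi] := eqVneq (m i) 0%N; first by rewrite scale0r msize0.
rewrite (leq_trans (msizeZ_le _ _))// msizeX.
by rewrite -[X in (_ <= mdeg X)%N](submK (m := U_(i))) ?lep1mP// mdegD mdeg1 addn1.
Qed.

Lemma msize_mderiv i p n : (msize p <= n)%N -> (msize p^`M(i) <= n.-1)%N.
Proof.
move=> pn; apply: (@msize_lin_ind n (mderiv i)) => // [c u v|m mn].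
  by rewrite mderivD mderivZ.
by rewrite (leq_trans (msize_mderivX _ _))// -ltnS (leq_trans mn)// leqSpred.
Qed.

Lemma msize_lap p n : (msize p <= n)%N -> (msize (lap p) <= n.-1)%N.
Proof.
move=> pn; apply: leq_trans (msize_sum _ _ _) _; apply/bigmax_leqP => i _.
by rewrite (leq_trans (msize_mderiv i (msize_mderiv i pn)))// leq_pred.
Qed.

(** The scalar by which [ballop k] acts on leading forms of degree [n]: for k = 2 (beta + 1) it is n
    (n + d + 2 beta). *)
Definition eigval k (n : nat) : K := n%:R * (n%:R + d%:R + k - 2).

Lemma ballopX k (m : 'X_{1..d}) :
  ballop k 'X_[m] = eigval k (mdeg m) *: 'X_[m] - lap 'X_[m].
Proof.
rewrite ballopE eulX -[(mdeg m)%:R *: 'X_[m]]addr0 eul_lin eulX (_ : eul 0 = 0); last first.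
  by rewrite /eul big1// => i _; rewrite mderiv0 mulr0.
rewrite !addr0 !scalerA -addrA -scalerDl addrC; congr (_ *: _ - _).
by rewrite /eigval; ring.
Qed.

Lemma msize_ballop k p n : (msize p <= n)%N -> (msize (ballop k p) <= n)%N.
Proof.
move=> pn; apply: (@msize_lin_ind n (ballop k)) => // [c u v|m mn].
  exact: ballop_lin.
rewrite ballopX (leq_trans (msizeD_le _ _))// msizeN geq_max.
rewrite (leq_trans (msizeZ_le _ _)) ?msizeX//=.
rewrite (leq_trans (msize_lap (n := n) _)) ?leq_pred// msizeX//.
Qed.

(** On monomials of degree exactly [n] the scalar parts cancel and only the Laplacian, of lower
    degree, survives. *)
Lemma msize_ballop_eigval k p n : (msize p <= n.+1)%N ->
  (msize (ballop k p - eigval k n *: p) <= n)%N.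
Proof.
move=> pn.
apply: (@msize_lin_ind n.+1 (fun p => ballop k p - eigval k n *: p)) => // [c u v|m mn].
  by rewrite ballop_lin -!mul_mpolyC; ring.
rewrite ballopX addrAC -scalerBl (leq_trans (msizeD_le _ _))// msizeN geq_max.
apply/andP; split; last by rewrite (leq_trans (msize_lap (n := n.+1) _))// msizeX.
move: mn; rewrite ltnS leq_eqVlt => /predU1P[->|mn].
  by rewrite subrr scale0r msize0.
by rewrite (leq_trans (msizeZ_le _ _))// msizeX.
Qed.

(** * Symmetry of L^(alpha) for an abstract functional; [I_div] is (1) with k = 2 (alpha + 1) *)

Section functional.
Variables (I : {mpoly K[d]} -> K) (k : K).
Hypothesis I_lin : forall c p q, I (c *: p + q) = c * I p + I q.
Hypothesis k_gt0 : 0 < k.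
Hypothesis I_div : forall i p, I ((1 - sqX) * p^`M(i)) = k * I ('X_i * p).

Lemma functional0 : I 0 = 0.
Proof.
have /eqP := I_lin 1 0 0; rewrite scale1r mul1r addr0.
by rewrite -subr_eq subrr => /eqP.
Qed.

Lemma functionalD p q : I (p + q) = I p + I q.
Proof. by have := I_lin 1 p q; rewrite scale1r mul1r. Qed.

Lemma functionalZ c p : I (c *: p) = c * I p.
Proof. by have := I_lin c p 0; rewrite !addr0 functional0 addr0. Qed.

Lemma functionalN p : I (- p) = - I p.
Proof. by rewrite -scaleN1r functionalZ mulN1r. Qed.

Lemma functionalB p q : I (p - q) = I p - I q.
Proof. by rewrite functionalD functionalN. Qed.

Lemma functional_sum J (r : seq J) (P : pred J) (F : J -> {mpoly K[d]}) :
  I (\sum_(j <- r | P j) F j) = \sum_(j <- r | P j) I (F j).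
Proof. exact: (big_morph I functionalD functional0). Qed.

(* Euler's identity for d_i f turns the hypothesis summed over the coordinates
   into a relation between I (d_i f) and I (sqX * d_i f). *)
Lemma functional_mulX i f c : eul f = c *: f ->
  (c + d%:R + k - 1) * I ('X_i * f) = I f^`M(i).
Proof.
move=> fc; set g := f^`M(i).
have gc : eul g = (c - 1) *: g.
  have := mderiv_eul i f; rewrite fc mderivZ -/g => /eqP.
  by rewrite -subr_eq => /eqP <-; rewrite scalerBl scale1r.
have E1 : I g - I (sqX * g) = k * I ('X_i * f).
  by rewrite -I_div -functionalB; congr I; rewrite mulrBl mul1r.
(* The hypothesis is applied to x_j g and summed over j; the derivatives d_j (x_j g) add up to d g +
   E g. *)
have E2 : (d%:R + c - 1) * (I g - I (sqX * g)) = k * I (sqX * g).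
  have : \sum_(j < d) I ((1 - sqX) * ('X_j * g)^`M(j)) = \sum_(j < d) k * I ('X_j ^+ 2 * g).
    by apply: eq_bigr => j _; rewrite I_div mulrA.
  rewrite -mulr_sumr -!functional_sum -!mulr_suml -/sqX -mulr_sumr => <-.
  rewrite -functionalB -functionalZ; congr I.
  under [in RHS]eq_bigr do rewrite mderivM mderivXU eqxx mul1r.
  rewrite big_split /= sumr_const card_ord -/(eul g) gc -[g *+ d]scaler_nat -scalerDl.
  by rewrite -scalerAr addrA; congr (_ *: _); rewrite mulrBl mul1r.
apply: (mulfI (lt0r_neq0 k_gt0)).
rewrite mulrCA -E1.
(* Adding k (I g - I (sqX g)) to both sides of [E2] leaves k I g on the right. *)
transitivity ((d%:R + c - 1) * (I g - I (sqX * g)) + k * (I g - I (sqX * g))).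
  by ring.
by rewrite E2; ring.
Qed.

(** For a monomial f, both d_i f and d_j f are Euler eigenvectors with the same eigenvalue, so
    [functional_mulX] expresses I (x_i d_j f) and I (x_j d_i f) by the same I (d_i d_j f), up to a
    common nonzero factor. *)
Lemma functional_rot i j p : I (rot i j p) = 0.
Proof.
elim/mpoly_lin_ind: p => [|c m p IHp].
  by rewrite /rot !mderiv0 !mulr0 subr0 functional0.
have -> : rot i j (c *: 'X_[m] + p) = c *: rot i j 'X_[m] + rot i j p.
  by rewrite /rot !mderivD !mderivZ -!mul_mpolyC; ring.
rewrite I_lin IHp addr0; have [->|m0] := eqVneq m 0%MM.
  by rewrite mpolyX0 /rot !mderivC !mulr0 subr0 functional0 mulr0.
have E l : eul ('X_[m]^`M(l) : {mpoly K[d]}) = ((mdeg m)%:R - 1) *: 'X_[m]^`M(l).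
  have := mderiv_eul l ('X_[m] : {mpoly K[d]}); rewrite eulX mderivZ => /eqP.
  by rewrite -subr_eq => /eqP <-; rewrite scalerBl scale1r.
have := functional_mulX i (E j); have := functional_mulX j (E i).
rewrite mderiv_comm => <- /eqP.
rewrite -subr_eq0 -mulrBr mulf_eq0 => /orP[|/eqP h]; last first.
  by rewrite /rot functionalB h mulr0.
rewrite gt_eqF//.
(* The degree of [m] and, because an index [i] exists, [d] are both at least 1, so the factor is [k]
   plus a natural number. *)
rewrite (_ : _ - 1 = ((mdeg m).-1 + d.-1)%:R + k).
  by rewrite ltr_wpDl.
have d0 : (0 < d)%N by apply: leq_ltn_trans (ltn_ord i).
have -> : d%:R = d.-1%:R + 1 :> K by rewrite natr1 prednK.
have -> : (mdeg m)%:R = (mdeg m).-1%:R + 1 :> K.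
  by rewrite natr1 prednK// lt0n mdeg_eq0.
by rewrite natrD; ring.
Qed.

(** [rot i j] is a derivation, and [I] kills its value on [u * v]. *)
Lemma functional_rotM i j u v : I (rot i j u * v) = - I (u * rot i j v).
Proof.
apply/eqP; rewrite -subr_eq0 opprK -functionalD -(functional_rot i j (u * v)).
by apply/eqP; congr I; rewrite /rot !mderivM; ring.
Qed.

(** Integration by parts: (1) for the product [u * v]. It makes d^beta_i the adjoint of d_i, the
    weight on the right having one more factor 1 - |x|^2. *)
Lemma functional_divM i u v :
  I ((- (1 - sqX) * u^`M(i) + k *: ('X_i * u)) * v) = I ((1 - sqX) * (u * v^`M(i))).
Proof.
apply/eqP; rewrite -subr_eq0 -functionalB.
have := I_div i (u * v); rewrite -functionalZ => /eqP; rewrite eq_sym -subr_eq0 -functionalB.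
congr (I _ == 0); rewrite mderivM -!mul_mpolyC; ring.
Qed.

(** The Dirichlet form of the operator, visibly symmetric in [u] and [v]. *)
Lemma functional_ballop_sym u v : I (ballop k u * v) =
  \sum_(i < d) I ((1 - sqX) * (u^`M(i) * v^`M(i)))
  + \sum_(i < d) \sum_(j < d | (i < j)%N) I (rot i j u * rot i j v).
Proof.
rewrite /ballop mulrBl !mulr_suml functionalB !functional_sum; congr (_ + _).
  by apply: eq_bigr => i _; rewrite functional_divM.
rewrite -sumrN; apply: eq_bigr => i _; rewrite mulr_suml functional_sum -sumrN.
by apply: eq_bigr => j _; rewrite (functional_rotM i j (rot i j u)) opprK.
Qed.

Lemma functional_ballop u v : I (ballop k u * v) = I (u * ballop k v).
Proof.
rewrite [u * _]mulrC !functional_ballop_sym; congr (_ + _).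
  by apply: eq_bigr => i _; rewrite [u^`M(i) * _]mulrC.
by apply: eq_bigr => i _; apply: eq_bigr => j _; rewrite mulrC.
Qed.

Lemma functional_ballop1 u : I (ballop k u) = 0.
Proof.
rewrite -[ballop k u]mulr1 functional_ballop /ballop.
rewrite !big1 ?subr0 ?mulr0 ?functional0// => i _.
  by rewrite big1// => j _; rewrite /rot !mderivC !mulr0 subrr !mderivC !mulr0 subrr.
by rewrite !mderivC !mulr0 scaler0 addr0.
Qed.

(** At real points, conjugating the coefficients conjugates the value, so [I (p * mconj q)] plays
    the part of <p, q>_alpha. *)
Definition mconj p : {mpoly K[d]} := map_mpoly (@Num.conj K) p.

Lemma mconjM p q : mconj (p * q) = mconj p * mconj q.
Proof. exact: rmorphM. Qed.

Lemma mconjD p q : mconj (p + q) = mconj p + mconj q.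
Proof. exact: raddfD. Qed.

Lemma mconjB p q : mconj (p - q) = mconj p - mconj q.
Proof. exact: raddfB. Qed.

Lemma mconjN p : mconj (- p) = - mconj p.
Proof. exact: raddfN. Qed.

Lemma mconj0 : mconj 0 = 0.
Proof. exact: raddf0. Qed.

Lemma mconj1 : mconj 1 = 1.
Proof. exact: rmorph1. Qed.

Lemma mconj_sum J (r : seq J) (P : pred J) (F : J -> {mpoly K[d]}) :
  mconj (\sum_(j <- r | P j) F j) = \sum_(j <- r | P j) mconj (F j).
Proof. exact: raddf_sum. Qed.

Lemma mconjZ c p : mconj (c *: p) = c^* *: mconj p.
Proof. exact: map_mpolyZ. Qed.

Lemma mconjX (m : 'X_{1..d}) : mconj 'X_[m] = 'X_[m].
Proof. exact: map_mpolyX. Qed.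

Lemma mconjK : involutive mconj.
Proof.
elim/mpoly_lin_ind => [|c m p IHp]; first by rewrite !mconj0.
by rewrite !mconjD !mconjZ !mconjX conjCK IHp.
Qed.

Lemma mconj_mderiv i p : mconj p^`M(i) = (mconj p)^`M(i).
Proof.
elim/mpoly_lin_ind: p => [|c m p IHp]; first by rewrite mderiv0 mconj0 mderiv0.
rewrite mconjD mconjZ mconjX !mderivD !mderivZ mconjD IHp mconjZ mderivX mconjZ mconjX.
by rewrite rmorph_nat.
Qed.

Lemma mconj_eul p : mconj (eul p) = eul (mconj p).
Proof.
by rewrite /eul mconj_sum; apply: eq_bigr => i _; rewrite mconjM mconjX mconj_mderiv.
Qed.

Lemma mconj_ballop c p : c \is Num.real -> mconj (ballop c p) = ballop c (mconj p).
Proof.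
move=> cr; rewrite !ballopE !mconjD mconjN mconjZ !mconj_eul mconj_sum.
congr (- _ + _ + _ *: _); last by rewrite conj_Creal// !rpredD ?rpredN ?realn.
by apply: eq_bigr => i _; rewrite !mconj_mderiv.
Qed.

(** * Positivity of the Hermitian form and its radical *)

Hypothesis I_conj : forall p, I (mconj p) = (I p)^*.
Hypothesis I_ge0 : forall p, 0 <= I (p * mconj p).
(** Definiteness is asked only of polynomials that do not vanish at the origin, where continuity
    suffices; [functional_radical_eq0] extends it to all. *)
Hypothesis I_neq0 : forall p, p@_0 != 0 -> I (p * mconj p) != 0.

Lemma functional_mulBB p q u v (a b : K) : I ((p - a *: q) * (u - b *: v))
  = I (p * u) - b * I (p * v) - a * I (q * u) + a * b * I (q * v).
Proof.
rewrite -!functionalZ -!functionalB -functionalD; congr I.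
by rewrite -!mul_mpolyC mpolyCM; ring.
Qed.

(* Cauchy-Schwarz. *)
Lemma functional_radical p q : I (p * mconj p) = 0 -> I (p * q) = 0.
Proof.
move=> p0; rewrite -[q]mconjK; move: (mconj q) => r.
have [z zE] : exists z, I (p * mconj r) = z by eexists.
have zJ : I (r * mconj p) = z^*.
  by rewrite -zE -I_conj mconjM mconjK mulrC.
rewrite zE.
apply/eqP; rewrite -[_ == 0]negbK; apply/negP => z0.
have zz : 0 < `|z| ^+ 2 by rewrite exprn_gt0// normr_gt0.
have rr := I_ge0 r.
have [t tr tz] : exists2 t, t^* = t & t * `|z| ^+ 2 = I (r * mconj r) + 1.
  exists ((I (r * mconj r) + 1) / `|z| ^+ 2); last by rewrite divfK ?gt_eqF.
  by rewrite conj_Creal// ger0_real// divr_ge0 ?addr_ge0// ltW.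
have tzJ : (t * z^*)^* = t * z by rewrite rmorphM /= tr conjCK.
have := I_ge0 (r - (t * z^*) *: p).
rewrite mconjB mconjZ tzJ functional_mulBB zE [X in _ - _ * X - _]zJ.
rewrite (_ : _ - _ - _ = I (r * mconj r) - 2 * t * (z * z^*)); last first.
  by move: (I _) z^* => a y; ring.
rewrite p0 mulr0 addr0 -normCK -mulrA tz => h.
have : 0 < I (r * mconj r) - 2 * (I (r * mconj r) + 1) + (I (r * mconj r) + 2).
  by rewrite ltr_wpDl// ltr_wpDl.
by rewrite (_ : _ + _ = 0) ?ltxx//; ring.
Qed.

(** All monomials of [sqX] have degree 2, so the order of vanishing at the origin rises by two. *)
Lemma mcoeff_sqXM p m n : (forall m', (mdeg m' < n)%N -> p@_m' = 0) ->
  (mdeg m < n.+2)%N -> (sqX * p)@_m = 0.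
Proof.
move=> pn mn; rewrite mcoeffM big1// => -[[k1 ?] [k2 ?]] /= /eqP mE.
have [k12|k12] := eqVneq (mdeg k1) 2.
  rewrite pn ?mulr0//; move: mn; rewrite mE mdegD k12; exact.
rewrite /sqX raddf_sum /= big1 ?mul0r// => i _; rewrite mcoeffXn.
by case: eqP => // k1E; case/eqP: k12; rewrite -k1E mdegMn mdeg1.
Qed.

(* The radical is stable under (1 - sqX) d_i, which lowers the order of vanishing
   at the origin by one; a nonzero element would thus give one with nonzero
   constant term. *)
Lemma functional_radical_eq0 p : (forall q, I (p * q) = 0) -> p = 0.
Proof.
move=> pN; apply/mpolyP => m; rewrite mcoeff0.
move: {2}(mdeg m).+1 (ltnSn (mdeg m)) => n.
elim: n p pN m => // n IHn p pN m mn.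
have IH (m' : 'X_{1..d}) : (mdeg m' < n)%N -> p@_m' = 0 by exact: IHn.
have [m0|m0] := eqVneq m 0%MM.
  rewrite m0; apply/eqP; rewrite -[_ == 0]negbK; apply/negP => /I_neq0.
  by rewrite pN eqxx.
have [i mi] : exists i, m i != 0%N.
  case: (pickP (fun i => m i != 0%N)) => [i mi|mm]; first by exists i.
  by case/eqP: m0; apply/mnmP => i; rewrite mnm0E; apply/eqP/negbFE/mm.
set m' := (m - U_(i))%MM.
have mE : (m' + U_(i))%MM = m by rewrite submK// lep1mP.
have degE : mdeg m = (mdeg m').+1 by rewrite -mE mdegD mdeg1 addn1.
have : ((1 - sqX) * p^`M(i))@_m' = 0.
  apply: IHn => [q|]; last by rewrite -ltnS -degE.
  (* Stability of the radical: after the product rule and (1), every term contains the factor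
     [p]. *)
  rewrite -mulrA (_ : p^`M(i) * q = (p * q)^`M(i) - p * q^`M(i)); last first.
    by rewrite mderivM addrK.
  rewrite mulrBr functionalB I_div mulrCA [(1 - _) * _]mulrCA !pN mulr0 subr0 //.
(* By induction the derivative of [p] vanishes to order [n.-1], so its product with [sqX] does not
   reach the degree of [m']. *)
rewrite mulrBl mul1r mcoeffB (@mcoeff_sqXM _ _ n.-1) ?subr0.
- rewrite mcoeff_deriv mE => /eqP; rewrite mulrn_eq0 => /orP[//|/eqP //].
- move=> u un; rewrite mcoeff_deriv IH ?mul0rn// mdegD mdeg1 addn1.
  by move: un; case: (n).
- by rewrite degE ltnS in mn; case: (n) mn => // n' h; rewrite (leq_trans h).
Qed.

(* The paper's <., .>_{alpha,1}, when I is the weighted integral. *)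
Definition sobolev p q : K :=
  \sum_(i < d) I (p^`M(i) * mconj q^`M(i)) + (I 1)^-1 * I p * (I q)^*.

(** The corrected operator: [k - 2] stands for 2 alpha, that is beta = alpha - 1, and the added
    constant is twice the mean of [eul p]. *)
Definition ballop_corr p : {mpoly K[d]} :=
  ballop (k - 2) p + 2 *: ((I 1)^-1 * I (eul p))%:MP.

Lemma functional1_neq0 : I 1 != 0.
Proof.
by have := @I_neq0 1; rewrite mconj1 mulr1; apply; rewrite mcoeff1 eqxx oner_neq0.
Qed.

(** Lowering [k] by 2 subtracts [2 *: eul p], whose mean the added constant restores; [ballop k p]
    itself has mean 0. *)
Lemma functional_ballop_corr p : I (ballop_corr p) = 0.
Proof.
have -> : ballop_corr p = ballop k p - 2 *: eul p + 2 *: ((I 1)^-1 * I (eul p))%:MP.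
  rewrite /ballop_corr !ballopE -!mul_mpolyC; congr (_ + _).
  by rewrite !(mpolyCD, mpolyCB, mpolyCN); ring.
rewrite functionalD functionalB functional_ballop1 !functionalZ -alg_mpolyC functionalZ.
by rewrite [_ * _ * I 1]mulrAC mulVf ?functional1_neq0// mul1r add0r addNr.
Qed.

Lemma mderiv_ballop_corr i p :
  (ballop_corr p)^`M(i) = ballop k p^`M(i) + (d%:R + k - 3) *: p^`M(i).
Proof.
rewrite mderivD mderivZ mderivC scaler0 addr0 mderiv_ballop subrK.
by congr (_ + _ *: _); ring.
Qed.

(** The mean terms vanish on both sides. In the gradient terms, differentiation turns the operator
    into [ballop k] plus a real scalar, which is symmetric for [I]. *)
Lemma sobolev_sym p q : sobolev (ballop_corr p) q = sobolev p (ballop_corr q).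
Proof.
have kr : k \is Num.real by rewrite gtr0_real.
rewrite /sobolev !functional_ballop_corr conjC0 !mulr0 mul0r; congr (_ + _).
apply: eq_bigr => i _; rewrite !mderiv_ballop_corr mulrDl mconjD mulrDr mconj_ballop//.
rewrite !functionalD functional_ballop; congr (_ + _).
rewrite mconjZ -scalerAl -scalerAr; congr (I (_ *: _)).
by rewrite conj_Creal// !rpredD ?rpredN ?realn.
Qed.

Lemma sobolev_lin c p q r : sobolev (c *: p + q) r = c * sobolev p r + sobolev q r.
Proof.
rewrite /sobolev I_lin !mulrDr !mulrDl addrACA; congr (_ + _); last first.
  by move: (I 1)^-1 (I r)^* => a b; ring.
rewrite mulr_sumr -big_split; apply: eq_bigr => i _ /=.
by rewrite mderivD mderivZ mulrDl -scalerAl I_lin.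
Qed.

(** All summands are nonnegative, hence zero: every d_i p lies in the radical and vanishes, and the
    constant left over has mean 0. *)
Lemma sobolev_eq0 p : sobolev p p = 0 -> p = 0.
Proof.
have c0 : 0 <= (I 1)^-1.
  by have := I_ge0 1; rewrite mconj1 mulr1 invr_ge0.
rewrite /sobolev -mulrA -normCK => /eqP.
rewrite paddr_eq0; last 2 first.
- by apply: sumr_ge0 => i _; exact: I_ge0.
- by rewrite mulr_ge0// exprn_ge0.
move=> /andP[]; rewrite psumr_eq0 => [/allP dp0|i _]; last exact: I_ge0.
rewrite mulf_eq0 invr_eq0 (negPf functional1_neq0) expf_eq0 normr_eq0 /= => /eqP Ip0.
have dp i : p^`M(i) = 0.
  apply: functional_radical_eq0 => q; apply: functional_radical.
  by apply/eqP; apply: dp0; rewrite mem_index_enum.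
have pC : p = (p@_0)%:MP.
  apply/mpolyP => m; rewrite mcoeffC.
  have [->|m0] := eqVneq m 0%MM; first by rewrite mulr1.
  case: (pickP (fun i => m i != 0%N)) => [i mi|mm]; last first.
    by case/eqP: m0; apply/mnmP => i; rewrite mnm0E; apply/eqP/negbFE/mm.
  have := mcoeff_deriv i (m - U_(i)) p; rewrite dp mcoeff0 submK ?lep1mP// => /esym/eqP.
  by rewrite mulrn_eq0 mulr0 => /orP[//|/eqP].
move: Ip0; rewrite pC -alg_mpolyC functionalZ => /eqP.
rewrite mulf_eq0 (negPf functional1_neq0) orbF.
by move=> /eqP ->; rewrite scale0r.
Qed.

(** The correction is a constant, of [msize] at most 1, whence [0 < n]. *)
Lemma msize_ballop_corr p n : (0 < n)%N ->
  (msize p <= n)%N -> (msize (ballop_corr p) <= n)%N.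
Proof.
move=> n0 pn; rewrite (leq_trans (msizeD_le _ _))// geq_max msize_ballop//=.
by rewrite (leq_trans (msizeZ_le _ _))// msizeC (leq_trans (leq_b1 _)).
Qed.

Lemma sobolev_orthogonal_eigen n p : (msize p <= n.+1)%N ->
  (forall q, (msize q <= n)%N -> sobolev p q = 0) ->
  ballop_corr p = eigval (k - 2) n *: p.
Proof.
case: n => [|n] pn pq.
  (* In degree 0 a constant correction is not of lower degree, so this case is computed: [p] is
     constant and both sides are 0. *)
  rewrite (msize1_polyC pn) /eigval mul0r scale0r /ballop_corr ballopE.
  have e0 c : eul c%:MP = 0 by rewrite /eul big1// => i _; rewrite mderivC mulr0.
  rewrite e0 -mpolyC0 e0 functional0 mulr0 mpolyC0 /lap !scaler0 !addr0 big1 ?oppr0// => i _.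
  by rewrite !mderivC.
apply/eqP; rewrite -subr_eq0; apply/eqP; set r := _ - _.
have rn : (msize r <= n.+1)%N.
  rewrite /r /ballop_corr addrAC (leq_trans (msizeD_le _ _))// geq_max.
  rewrite msize_ballop_eigval//= (leq_trans (msizeZ_le _ _))// msizeC.
  by rewrite (leq_trans (leq_b1 _)).
apply: sobolev_eq0.
(* Only the first [r] in <r, r> is expanded; symmetry moves the operator onto the second one, whose
   degree stays in the range orthogonal to [p]. *)
rewrite {1}/r addrC -scaleNr sobolev_lin pq// mulr0 add0r sobolev_sym.
exact/pq/msize_ballop_corr.
Qed.

End functional.

End ball_operator.

(** * The weight in one dimension *)

Section one_dim.
Local Open Scope classical_set_scope.
Local Open Scope ring_scope.
Variable R : realType.
Implicit Types (a r t c : R) (k : nat).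
Notation mu := (@lebesgue_measure R).

(* `^ takes the value 1 on negative bases, so the weight is cut off by hand. *)
Definition pospow a x : R := if 0 < x then x `^ a else 0.

Lemma pospow_ge0 a x : 0 <= pospow a x.
Proof. by rewrite /pospow; case: ifP => // _; exact: powR_ge0. Qed.

Lemma pospow_le0 a x : x <= 0 -> pospow a x = 0.
Proof. by rewrite /pospow ltNge => ->. Qed.

Lemma measurable_pospow a : measurable_fun setT (pospow a).
Proof.
by apply: measurable_fun_ifT => //; exact: measurable_fun_ltr.
Qed.

(** The integrand of the one-dimensional (1) is an exact derivative. At [k = 0] the truncated
    exponent [k.-1] has coefficient 0. *)
Lemma is_derive_pow_sphere a r k t : 0 < r - t ^+ 2 ->
  is_derive t 1 (fun t : R => t ^+ k * (r - t ^+ 2) `^ (a + 1))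
    ((k%:R * t ^+ k.-1 * (r - t ^+ 2) - 2 * (a + 1) * t ^+ k.+1)
     * (r - t ^+ 2) `^ a).
Proof.
move=> h.
have h1 : is_derive t 1 (fun t : R => r - t ^+ 2) (- (2 * t)).
  apply: is_derive_eq. 
  by rewrite /GRing.scale /=; ring.
have h2 := is_derive1_powR (a + 1) h.
have h3 := @is_derive1_comp _ (fun x : R => x `^ (a + 1))
  (fun t : R => r - t ^+ 2) t _ _ h2 h1.
have h4 : is_derive t 1 (fun t : R => t ^+ k) (k%:R * t ^+ k.-1).
  have := is_deriveX k (is_derive_id t (1 : R)).
  rewrite exprfctE => h4; apply: is_derive_eq h4 _.
  by rewrite /GRing.scale /= mulr1.
have h5 := @is_deriveM _ _ (fun t : R => t ^+ k)
  ((fun x : R => x `^ (a + 1)) \o (fun t => r - t ^+ 2)) _ _ _ _ h4 h3.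
apply: (@is_derive_eq _ _ _ _ _ _ _ _ h5).
rewrite /= addrK powRD; last by rewrite (gt_eqF h) implybT.
rewrite powRr1 ?ltW// /GRing.scale /=. rewrite (exprS t k).
move: (_ `^ a) (t ^+ k.-1) (t ^+ k) (k%:R : R) => u v w z; ring.
Qed.

Lemma sphere_itv_gt0 r c t : c ^+ 2 < r -> t \in `[- c, c] -> 0 < r - t ^+ 2.
Proof.
rewrite in_itv /= -ler_norml => cr tc; rewrite subr_gt0 (le_lt_trans _ cr)//.
rewrite -real_normK ?num_real// lerXn2r// ?nnegrE//.
exact: le_trans (normr_ge0 t) tc.
Qed.

Lemma within_continuous_pow_sphere a r c : c ^+ 2 < r ->
  {within `[- c, c], continuous (fun t => (r - t ^+ 2) `^ a)}.
Proof.
move=> cr; apply: continuous_in_subspaceT => t /set_mem /(sphere_itv_gt0 cr) h.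
apply/differentiable_continuous/derivable1_diffP.
(* Exponent [a - 1] and [k = 0] make the differentiated function the power itself. *)
have := is_derive_pow_sphere (a - 1) 0 h.
under [X in is_derive _ _ X _]eq_fun do rewrite expr0 mul1r subrK.
by case.
Qed.

Lemma within_continuous_derivative_pow_sphere a r k c : c ^+ 2 < r ->
  {within `[- c, c], continuous
    (fun t => (k%:R * t ^+ k.-1 * (r - t ^+ 2) - 2 * (a + 1) * t ^+ k.+1)
      * (r - t ^+ 2) `^ a)}.
Proof.
move=> cr t; apply: (@continuousM _ (subspace `[- c, c])
  (fun t : R => k%:R * t ^+ k.-1 * (r - t ^+ 2) - 2 * (a + 1) * t ^+ k.+1)
  (fun t : R => (r - t ^+ 2) `^ a)); last exact: within_continuous_pow_sphere.
apply: continuous_subspaceT => {}t.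
by apply: cvgB; [apply: cvgM; [apply: cvgM|apply: cvgB]|apply: cvgM];
  (exact: cvg_cst || exact: exprn_continuous).
Qed.

Lemma integral_derivative_pow_sphere a r k c : 0 < c -> c ^+ 2 < r ->
  (\int[mu]_(t in `[(- c)%R, c])
     ((k%:R * t ^+ k.-1 * (r - t ^+ 2) - 2 * (a + 1) * t ^+ k.+1)
       * (r - t ^+ 2) `^ a)%:E
   = ((c ^+ k - (- c) ^+ k) * (r - c ^+ 2) `^ (a + 1))%:E)%E.
Proof.
move=> c0 cr.
have dF t : t \in `[- c, c] ->
    derivable (fun t => t ^+ k * (r - t ^+ 2) `^ (a + 1)) t 1.
  by move=> /(sphere_itv_gt0 cr) h; have [] := is_derive_pow_sphere a k h.
have cF t : t \in `[- c, c] ->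
    {for t, continuous (fun t => t ^+ k * (r - t ^+ 2) `^ (a + 1))}.
  by move=> /dF h; apply/differentiable_continuous/derivable1_diffP.
rewrite (@continuous_FTC2 _ _ (fun t => t ^+ k * (r - t ^+ 2) `^ (a + 1))).
- by rewrite sqrrN -EFinB mulrBl.
- by rewrite ltrNl (lt_trans _ c0)// oppr_lt0.
- exact: within_continuous_derivative_pow_sphere.
- split.
  + by move=> t /subset_itv_oo_cc /dF.
  + apply: cvg_at_right_filter; apply: cF.
    by rewrite in_itv /= lexx lerNl (le_trans _ (ltW c0))// oppr_le0 ltW.
  + apply: cvg_at_left_filter; apply: cF.
    by rewrite in_itv /= lexx andbT lerNl (le_trans _ (ltW c0))// oppr_le0 ltW.
- move=> t /subset_itv_oo_cc /(sphere_itv_gt0 cr) h.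
  by rewrite derive1E; have [] := is_derive_pow_sphere a k h.
Qed.

(** Half-lengths of compact intervals filling (-sqrt r, sqrt r); [n.+2] keeps the factor strictly
    between 0 and 1 from [n = 0] on. *)
Definition exhaust r (n : nat) : R := Num.sqrt r * (1 - n.+2%:R^-1).

Lemma exhaust_gt0 r n : 0 < r -> 0 < exhaust r n.
Proof.
by move=> r0; rewrite mulr_gt0 ?sqrtr_gt0// subr_gt0 invf_lt1// ltr1n.
Qed.

Lemma exhaust_lt r n : 0 < r -> exhaust r n ^+ 2 < r.
Proof.
move=> r0; rewrite exprMn sqr_sqrtr ?ltW// gtr_pMr// expr_lt1//.
by rewrite subr_ge0 invf_le1// ler1n.
Qed.

Lemma exhaust_nd r : {homo exhaust r : m n / (m <= n)%N >-> m <= n}.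
Proof.
by move=> m n mn; rewrite ler_wpM2l ?sqrtr_ge0// lerD2l lerN2 lef_pV2 ?posrE// ler_nat.
Qed.

Lemma cvg_exhaust r : exhaust r n @[n --> \oo] --> Num.sqrt r.
Proof.
rewrite -[X in _ --> X]mulr1; apply: cvgM; first exact: cvg_cst.
rewrite -[X in _ --> X]subr0; apply: cvgB; first exact: cvg_cst.
by have := @cvg_harmonic R; rewrite -cvg_shiftS.
Qed.

Lemma cvgn_expr (u : R ^nat) (l : R) k :
  u n @[n --> \oo] --> l -> u n ^+ k @[n --> \oo] --> l ^+ k.
Proof.
move=> ul; elim: k => [|k IHk]; first exact: cvg_cst.
by under eq_fun do rewrite exprS; rewrite exprS; exact: cvgM.
Qed.

Lemma near_exhaust r t : t ^+ 2 < r ->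
  \forall n \near \oo, t \in `[- exhaust r n, exhaust r n].
Proof.
move=> tr; have r0 : 0 < r by rewrite (le_lt_trans _ tr)// sqr_ge0.
have tsr : `|t| < Num.sqrt r.
  by rewrite -sqrtr_sqr ltr_sqrt.
near=> n; rewrite in_itv /= -ler_norml ltW//; near: n.
by apply: (@cvgr_gt _ _ _ _ _ (Num.sqrt r)) => //; exact: cvg_exhaust.
Unshelve. all: by end_near. Qed.

(* Comes from integrating the derivative of t (r - t^2)^(a+1). *)
Lemma Rintegral_pow_sphere_le a r c : -1 < a -> 0 < c -> c ^+ 2 < r ->
  \int[mu]_(t in `[- c, c]) (r - t ^+ 2) `^ a
    <= (2 * a + 3) / (a + 1) * r `^ (a + 2^-1).
Proof.
move=> a1 c0 cr; have r0 : 0 < r by rewrite (le_lt_trans _ cr)// sqr_ge0.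
have a1' : 0 < a + 1 by lra.
have a3 : 0 < 2 * a + 3 by lra.
have cc : - c < c by lra.
have arith (P H x y z : R) : 0 <= H -> z <= y ->
    2 * (a + 1) * r * P + H <= (2 * a + 3) * x * (c + c) ->
    x * c <= z -> 2 * r * (P * (a + 1)) <= 2 * ((2 * a + 3) * y).
  move=> H0 zy h xz.
  have : (2 * a + 3) * (x * c) <= (2 * a + 3) * y.
    by rewrite ler_wpM2l ?(le_trans xz)// ltW.
  lra.
have iP : mu.-integrable `[- c, c] (EFin \o (fun t => (r - t ^+ 2) `^ a)).
  apply: continuous_compact_integrable; first exact: segment_compact.
  exact: within_continuous_pow_sphere.
have [h hE] : exists h, h = fun t => (1%:R * t ^+ 0 * (r - t ^+ 2)
    - 2 * (a + 1) * t ^+ 2) * (r - t ^+ 2) `^ a by eexists.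
have ih : mu.-integrable `[- c, c] (EFin \o h).
  rewrite hE; apply: continuous_compact_integrable; first exact: segment_compact.
  exact: (@within_continuous_derivative_pow_sphere a r 1).
have h0 : 0 <= \int[mu]_(t in `[- c, c]) h t.
  rewrite hE /Rintegral (@integral_derivative_pow_sphere a r 1)//=.
  by rewrite mulr_ge0 ?powR_ge0// !expr1 opprK addr_ge0// ltW.
have ic x : mu.-integrable `[- c, c] (EFin \o (fun=> x : R)).
  apply: continuous_compact_integrable; first exact: segment_compact.
  by move=> ?; exact: cvg_cst.
have iP' : mu.-integrable `[- c, c]
    (EFin \o (fun t => 2 * (a + 1) * r * (r - t ^+ 2) `^ a)).
  by apply: (integrableZl _ _ iP) => //; exact: measurable_itv.
have : \int[mu]_(t in `[- c, c]) (2 * (a + 1) * r * (r - t ^+ 2) `^ a + h t)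
   <= \int[mu]_(t in `[- c, c]) ((2 * a + 3) * r `^ (a + 1)).
  apply: le_Rintegral => //.
    by apply: (integrableD _ iP' ih); exact: measurable_itv.
  move=> t tc; have rt := sphere_itv_gt0 cr tc.
  (* Adding the derivative [h], whose integral is nonnegative, leaves a multiple of (r - t^2)^(a+1),
     which is largest at t = 0. *)
  have -> : 2 * (a + 1) * r * (r - t ^+ 2) `^ a + h t
    = (2 * a + 3) * (r - t ^+ 2) `^ (a + 1).
    rewrite hE powRD; last by rewrite (gt_eqF rt) implybT.
    by rewrite powRr1 ?ltW//; ring.
  by rewrite ler_pM2l// ge0_ler_powR ?nnegrE ?gerBl ?sqr_ge0// ltW.
rewrite RintegralD// RintegralZl// Rintegral_cst//=.
rewrite lebesgue_measure_itv /= lte_fin cc.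
rewrite /= opprK => H.
have cs : c <= Num.sqrt r by rewrite -[c]gtr0_norm// -sqrtr_sqr ler_sqrt// ltW.
have Er : r `^ (a + 1) * Num.sqrt r = r * r `^ (a + 2^-1).
  rewrite -powR12_sqrt ?ltW// -{3}[r]powRr1 ?ltW// -!powRD ?(gt_eqF r0) ?implybT//.
  by congr (_ `^ _); ring.
rewrite mulrAC ler_pdivlMr// -(@ler_pM2l _ (2 * r)) ?mulr_gt0//.
rewrite -[leRHS]mulrA [r * _]mulrCA.
by apply: arith H _ => //; rewrite -Er ler_wpM2l// powR_ge0.
Qed.

Lemma measurable_pospow_sphere a r :
  measurable_fun setT (fun t => pospow a (r - t ^+ 2)).
Proof.
apply: measurableT_comp; first exact: measurable_pospow.
by apply: measurable_funB => //; exact: measurable_funX.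
Qed.

(** The sequence is eventually constant: inside, [t] lies in all late intervals; outside, [f t] is
    0. *)
Lemma cvg_restrict_exhaust r (f : R -> \bar R) t :
  (forall t, r <= t ^+ 2 -> f t = 0%E) ->
  (f \_ `[- exhaust r n, exhaust r n]) t @[n --> \oo] --> f t.
Proof.
move=> f0; apply: cvg_near_cst.
have [/f0 ft|tr] := leP r (t ^+ 2).
  by apply: nearW => n; rewrite patchE ft; case: ifP.
by apply: filterS (near_exhaust tr) => n nt; rewrite patchE mem_set.
Qed.

(** Monotone convergence along [exhaust]. Integrating out one coordinate raises the exponent by 1/2,
    which drives the induction on the dimension. *)
Lemma integral_pospow_sphere_le a r : -1 < a ->
  (\int[mu]_t (pospow a (r - t ^+ 2))%:E
     <= ((2 * a + 3) / (a + 1) * pospow (a + 2^-1) r)%:E)%E.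
Proof.
move=> a1; have [r0|r0] := ltP 0 r; last first.
  rewrite integral0_eq ?pospow_le0 ?mulr0// => t _.
  by rewrite pospow_le0// subr_le0 (le_trans r0)// sqr_ge0.
pose f t := (pospow a (r - t ^+ 2))%:E.
have f_ge0 t : (0 <= f t)%E by rewrite lee_fin pospow_ge0.
have mf : measurable_fun setT f.
  by apply/measurable_EFinP; exact: measurable_pospow_sphere.
pose K n : set R := `[- exhaust r n, exhaust r n]%classic.
have mK n : measurable (K n) by exact: measurable_itv.
have mfK n : measurable_fun setT (f \_ (K n)).
  apply/(measurable_restrictT f (mK n)); exact: (measurable_funTS mf).
have cvgf t : (f \_ (K n)) t @[n --> \oo] --> f t.
  apply: cvg_restrict_exhaust => {}t rt.
  by rewrite /f pospow_le0// subr_le0.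
have <- : (\int[mu]_t limn (fun n => (f \_ (K n)) t) = \int[mu]_t f t)%E.
  by apply: eq_integral => t _; apply/cvg_lim => //; exact: cvgf.
have cv := @cvg_monotone_convergence _ _ _ mu setT measurableT (fun n => f \_ (K n)).
have {}cv := cv mfK (fun n t _ => erestrict_ge0 (fun x _ => f_ge0 x) t).
have nd t : setT t -> nondecreasing_seq (fun n => (f \_ (K n)) t).
  move=> _ m n mn; apply: restrict_lee => // s.
  by rewrite /K /= !in_itv /= -!ler_norml => /le_trans; apply; exact: exhaust_nd.
rewrite -(cvg_lim _ (cv nd))//; apply: lime_le; first exact: cvgP (cv nd).
apply: nearW => n; rewrite -integral_mkcond.
have := Rintegral_pow_sphere_le a1 (exhaust_gt0 n r0) (exhaust_lt n r0).
rewrite -lee_fin /pospow r0; apply: le_trans.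
rewrite fineK.
  rewrite le_eqVlt; apply/orP; left; apply/eqP; apply: eq_integral => t /set_mem Kt.
  by rewrite /f /pospow (sphere_itv_gt0 _ Kt)// exhaust_lt.
apply: integrable_fin_num => //.
apply: continuous_compact_integrable; first exact: segment_compact.
by apply: within_continuous_pow_sphere; exact: exhaust_lt.
Qed.

(** Dominated convergence along [exhaust]: the polynomial factor is bounded, the weight is
    integrable, and the boundary terms tend to 0. *)
Lemma integral_derivative_pospow_sphere a r k (f := fun t =>
    ((k%:R * t ^+ k.-1 * (r - t ^+ 2) - 2 * (a + 1) * t ^+ k.+1)
      * pospow a (r - t ^+ 2))%:E) : -1 < a ->
  mu.-integrable setT f /\ (\int[mu]_t f t = 0)%E.
Proof.
rewrite {}/f => a1; have [r0|r0] := ltP 0 r; last first.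
  have E t : (k%:R * t ^+ k.-1 * (r - t ^+ 2) - 2 * (a + 1) * t ^+ k.+1)
      * pospow a (r - t ^+ 2) = 0.
    by rewrite pospow_le0 ?mulr0// subr_le0 (le_trans r0)// sqr_ge0.
  under eq_fun do rewrite E; split; first exact: integrable0.
  by rewrite integral0_eq// => t _; rewrite E.
pose h t := k%:R * t ^+ k.-1 * (r - t ^+ 2) - 2 * (a + 1) * t ^+ k.+1.
pose f t := (h t * pospow a (r - t ^+ 2))%:E.
have mf : measurable_fun setT f.
  apply/measurable_EFinP; apply: measurable_funM; last exact: measurable_pospow_sphere.
  by do ![apply: measurable_funB|apply: measurable_funM] => //; exact: measurable_funX.
pose K n : set R := `[- exhaust r n, exhaust r n]%classic.
have mK n : measurable (K n) by exact: measurable_itv.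
have mfK n : measurable_fun setT (f \_ (K n)).
  apply/(measurable_restrictT f (mK n)); exact: (measurable_funTS mf).
have f0 t : r <= t ^+ 2 -> f t = 0%E.
  by move=> rt; rewrite /f pospow_le0 ?mulr0// subr_le0.
(* Triangle inequality for [h] with |t| at most sqrt r. *)
pose M := k%:R * Num.sqrt r ^+ k.-1 * r + 2 * (a + 1) * Num.sqrt r ^+ k.+1.
have hM t : t ^+ 2 < r -> `|h t| <= M.
  move=> tr; have ts : `|t| <= Num.sqrt r by rewrite -sqrtr_sqr ler_sqrt ?ltW.
  rewrite /h (le_trans (ler_normB _ _))// !normrM !normrX !normr_nat.
  rewrite (ger0_norm (x := a + 1)); last by lra.
  apply: lerD; last by rewrite ler_wpM2l ?mulr_ge0 ?lerXn2r ?nnegrE ?sqrtr_ge0//; lra.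
  apply: ler_pM => //.
    by rewrite ler_wpM2l ?lerXn2r ?nnegrE ?sqrtr_ge0.
  by rewrite ger0_norm ?gerBl ?sqr_ge0// subr_ge0 ltW.
have M0 : 0 <= M.
  by apply: le_trans (hM 0 _); rewrite ?expr0n.
have [] := @dominated_convergence _ _ _ mu _ measurableT (fun n => f \_ (K n)) f
  (fun t => (M * pospow a (r - t ^+ 2))%:E).
- exact: mfK.
- exact: mf.
- by apply: aeW => t _; exact: cvg_restrict_exhaust.
- apply/integrableP; split.
    apply/measurable_EFinP; apply: measurable_funM => //.
    exact: measurable_pospow_sphere.
  under eq_integral do rewrite gee0_abs ?lee_fin ?mulr_ge0 ?pospow_ge0// EFinM.
  rewrite ge0_integralZl ?lee_fin//; last first.
  + by move=> t _; rewrite lee_fin pospow_ge0.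
  + by apply/measurable_EFinP; exact: measurable_pospow_sphere.
  rewrite lte_mul_pinfty ?lee_fin// (le_lt_trans (integral_pospow_sphere_le _ a1))//.
  by rewrite ltry.
- apply: aeW => t n _; have [rt|tr] := leP r (t ^+ 2).
    by rewrite patchE f0// if_same abse0 lee_fin mulr_ge0// pospow_ge0.
  apply: (@le_trans _ _ `|f t|%E).
    by rewrite patchE; case: ifP => // _; rewrite abse0 abse_ge0.
  rewrite lee_fin normrM [`|pospow _ _|]ger0_norm ?pospow_ge0//.
  by rewrite ler_wpM2r ?pospow_ge0// hM.
- move=> fi _ /cvg_unique p; split; [exact: fi|].
  apply: p => //.
  rewrite (_ : [sequence _]_n = EFin \o (fun n => (exhaust r n ^+ k - (- exhaust r n) ^+ k)
     * (r - exhaust r n ^+ 2) `^ (a + 1))); last first.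
    apply/funext => n /=; rewrite -integral_mkcond -integral_derivative_pow_sphere.
    + apply: eq_integral => t /set_mem Kt.
      by rewrite /f /pospow (sphere_itv_gt0 _ Kt)// exhaust_lt.
    + exact: exhaust_gt0.
    + exact: exhaust_lt.
  apply: cvg_EFin; first exact: nearW.
  rewrite -[X in _ --> X](mulr0 (Num.sqrt r ^+ k - (- Num.sqrt r) ^+ k)).
  apply: cvgM.
    by apply: cvgB; apply: cvgn_expr; [|apply: cvgN]; exact: cvg_exhaust.
  (* The boundary factor is a positive power of a positive quantity tending to 0. *)
  have a1' : 0 < a + 1 by lra.
  apply: (cvg_at_rightP _ _ _).1 (powR_cvg0 a1') _ _; split.
    by move=> n; rewrite subr_gt0 exhaust_lt.
  rewrite -[X in _ --> X](subrr r); apply: cvgB; first exact: cvg_cst.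
  rewrite -[X in _ --> X](sqr_sqrtr (ltW r0)); by apply: cvgn_expr; exact: cvg_exhaust.
Qed.

End one_dim.

(** * Integration over balls of R^d *)

Section tuple_integral.
Local Open Scope classical_set_scope.
Local Open Scope ring_scope.
Variable R : realType.
Implicit Types (a r t c s : R) (k d : nat).
Notation mu := (@lebesgue_measure R).
Notation leb d := (lebesgue_tuple R d).

(** * Peeling off the first coordinate, and integrability of the weight *)

Lemma ge0_integral_tupleS d (f : d.+1.-tuple R -> \bar R) :
  measurable_fun setT f -> (forall y, 0 <= f y)%E ->
  (\int[leb d.+1]_y f y = \int[(mu \x leb d)%E]_z f (tuple_cons z))%E.
Proof.
move=> mf f0.
rewrite -[RHS](@ge0_integral_pushforward _ _ (measurableTypeR R * d.-tuple R)%type _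
  _ (@tuple_cons R d) _ (mu \x leb d)%E setT f)//.
exact: measurable_tuple_cons.
Qed.

Lemma integrable_tupleS d (f : d.+1.-tuple R -> \bar R) :
  (leb d.+1).-integrable setT f ->
  (mu \x leb d)%E.-integrable setT (f \o @tuple_cons R d).
Proof.
move=> /integrableP[mf foo]; apply/integrableP; split.
  by apply: measurableT_comp => //; exact: measurable_tuple_cons.
rewrite -(ge0_integral_tupleS (f := fun y => `|f y|%E))//.
exact: measurableT_comp.
Qed.

Lemma integral_tupleS d (f : d.+1.-tuple R -> \bar R) :
  (leb d.+1).-integrable setT f ->
  (\int[leb d.+1]_y f y = \int[(mu \x leb d)%E]_z f (tuple_cons z))%E.
Proof.
move=> fi; have /integrableP[mf _] := fi.
rewrite -[RHS](@integral_pushforward _ _ (measurableTypeR R * d.-tuple R)%type _ _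
  (@tuple_cons R d) _ (mu \x leb d)%E setT f mf (integrable_tupleS fi))//.
exact: measurable_tuple_cons.
Qed.

Lemma sqnorm_cons d (z : R * d.-tuple R) :
  sqnorm (tuple_cons z) = z.1 ^+ 2 + sqnorm z.2.
Proof.
rewrite /sqnorm big_ord_recl tnth0; congr (_ + _).
by apply: eq_bigr => i _; rewrite tnthS; congr (tnth _ _ ^+ 2); exact: val_inj.
Qed.

Lemma measurable_sqnorm d : measurable_fun setT (@sqnorm R d).
Proof.
apply: measurable_sum => i; apply: measurable_funX; exact: measurable_tnth.
Qed.

Lemma measurable_weight d a s :
  measurable_fun setT (fun y : d.-tuple R => pospow a (s - sqnorm y)).
Proof.
apply: measurableT_comp; first exact: measurable_pospow.
by apply: measurable_funB => //; exact: measurable_sqnorm.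
Qed.

(** Induction on [d] for all exponents: by Tonelli the first coordinate is integrated first, and a +
    1/2 is again above -1. *)
Lemma integral_weight_lty d a s : -1 < a ->
  (\int[leb d]_y (pospow a (s - sqnorm y))%:E < +oo)%E.
Proof.
elim: d a => [|d IHd] a a1.
  rewrite integral_dirac// ?diracT ?mul1e ?ltry//.
  by apply/measurable_EFinP; exact: measurable_weight.
rewrite ge0_integral_tupleS; first last.
- by move=> y; rewrite lee_fin pospow_ge0.
- by apply/measurable_EFinP; exact: measurable_weight.
have mf : measurable_fun setT (fun z : R * d.-tuple R =>
    (pospow a (s - sqnorm (tuple_cons z)))%:E).
  apply/measurable_EFinP.
  apply: (measurableT_comp (measurable_weight a s)); exact: measurable_tuple_cons.
rewrite fubini_tonelli2//; last by move=> z; rewrite lee_fin pospow_ge0.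
pose C := (2 * a + 3) / (a + 1).
apply: (@le_lt_trans _ _ (\int[leb d]_y (C%:E * (pospow (a + 2^-1) (s - sqnorm y))%:E))%E).
  apply: ge0_le_integral => //.
  - by move=> y _; apply: integral_ge0 => t _; rewrite lee_fin pospow_ge0.
  - apply: measurable_fun_fubini_tonelli_G; first exact: mf.
    by move=> z; rewrite lee_fin pospow_ge0.
  - by apply/measurable_EFinP; apply: measurable_funM => //; exact: measurable_weight.
  - move=> y _; rewrite /fubini_G.
    under eq_integral do rewrite sqnorm_cons/= opprD addrCA addrC.
    exact: integral_pospow_sphere_le.
rewrite ge0_integralZl//.
- by rewrite lte_mul_pinfty ?lee_fin ?divr_ge0// ?IHd//; lra.
- by apply/measurable_EFinP; exact: measurable_weight.
- by move=> y _; rewrite lee_fin pospow_ge0.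
- by rewrite lee_fin divr_ge0//; lra.
Qed.

Lemma integrable_mul_weight d a s (C : R) (f : d.-tuple R -> R) : -1 < a ->
  measurable_fun setT f -> (forall y, sqnorm y < s -> `|f y| <= C) ->
  (leb d).-integrable setT (fun y => (f y * pospow a (s - sqnorm y))%:E).
Proof.
move=> a1 mf fC; apply/integrableP; split.
  by apply/measurable_EFinP; apply: measurable_funM => //; exact: measurable_weight.
have C0 : 0 <= `|C| by [].
apply: (@le_lt_trans _ _ (\int[leb d]_y (`|C|%:E * (pospow a (s - sqnorm y))%:E))%E).
  apply: ge0_le_integral => //.
  - apply: measurableT_comp => //; apply/measurable_EFinP.
    by apply: measurable_funM => //; exact: measurable_weight.
  - by apply/measurable_EFinP; apply: measurable_funM => //; exact: measurable_weight.
  - move=> y _; rewrite lee_fin normrM [`|pospow _ _|]ger0_norm ?pospow_ge0//.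
    have [ys|ys] := ltP (sqnorm y) s.
      rewrite ler_wpM2r ?pospow_ge0// (le_trans (fC _ ys))// ler_norm//.
    by rewrite pospow_le0 ?mulr0// subr_le0.
rewrite ge0_integralZl//.
- by rewrite lte_mul_pinfty ?lee_fin//; exact: integral_weight_lty.
- by apply/measurable_EFinP; exact: measurable_weight.
- by move=> y _; rewrite lee_fin pospow_ge0.
Qed.

(** * Monomials and the divergence identity on balls of any radius *)

Definition mon d (m : 'I_d -> nat) (y : d.-tuple R) : R :=
  \prod_(i < d) tnth y i ^+ m i.

(** The j-th partial derivative of [mon m], in product form so that coordinates can be peeled
    off. *)
Definition dmon d (m : 'I_d -> nat) (j : 'I_d) (y : d.-tuple R) : R :=
  (m j)%:R * tnth y j ^+ (m j).-1 * \prod_(i < d | i != j) tnth y i ^+ m i.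

Lemma mon_cons d (m : 'I_d.+1 -> nat) z :
  mon m (tuple_cons z) = z.1 ^+ m ord0 * mon (m \o lift ord0) z.2.
Proof.
rewrite /mon big_ord_recl tnth0; congr (_ * _).
by apply: eq_bigr => i _; rewrite tnthS; congr (tnth _ _ ^+ _); exact: val_inj.
Qed.

Lemma dmon_cons0 d (m : 'I_d.+1 -> nat) z :
  dmon m ord0 (tuple_cons z)
    = (m ord0)%:R * z.1 ^+ (m ord0).-1 * mon (m \o lift ord0) z.2.
Proof.
rewrite /dmon tnth0 big_mkcond big_ord_recl /= mul1r; congr (_ * _).
by apply: eq_bigr => i _; rewrite tnthS; congr (tnth _ _ ^+ _); exact: val_inj.
Qed.

Lemma dmon_consS d (m : 'I_d.+1 -> nat) (j : 'I_d) z :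
  dmon m (lift ord0 j) (tuple_cons z)
    = z.1 ^+ m ord0 * dmon (m \o lift ord0) j z.2.
Proof.
have E i : tnth (tuple_cons z) (lift ord0 i) = tnth z.2 i.
  by rewrite tnthS; congr tnth; exact: val_inj.
rewrite /dmon E big_mkcond big_ord_recl /= tnth0 mulrCA; congr (_ * _).
rewrite [in RHS]big_mkcond /=; congr (_ * _).
by apply: eq_bigr => i _; rewrite E (inj_eq lift_inj).
Qed.

(** A crude bound free of square roots, from (|y_i| - 1)^2 >= 0. *)
Lemma norm_tnth_le d (y : d.-tuple R) i s : sqnorm y < s -> `|tnth y i| <= 1 + s.
Proof.
move=> ys; have : tnth y i ^+ 2 <= s.
  rewrite (le_trans _ (ltW ys))// /sqnorm (bigD1 i)//= lerDl.
  by apply: sumr_ge0 => j _; exact: sqr_ge0.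
move=> h; have : (`|tnth y i| - 1) ^+ 2 >= 0 by exact: sqr_ge0.
rewrite sqrrB1 real_normK ?num_real// -mulr_natl; have := normr_ge0 (tnth y i); nra.
Qed.

(** A class closed under ring operations and containing the coordinates, each member being
    integrable against the weight. *)
Definition ball_bounded d s (f : d.-tuple R -> R) :=
  measurable_fun setT f /\ exists C, forall y, sqnorm y < s -> `|f y| <= C.

Lemma ball_bounded_integrable d a s (f : d.-tuple R -> R) : -1 < a ->
  ball_bounded s f ->
  (leb d).-integrable setT (fun y => (f y * pospow a (s - sqnorm y))%:E).
Proof. by move=> a1 [mf [C fC]]; exact: integrable_mul_weight fC. Qed.

Lemma ball_bounded_cst d s c : @ball_bounded d s (fun=> c).
Proof. by split => //; exists `|c|. Qed.

Lemma ball_boundedD d s (f g : d.-tuple R -> R) :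
  ball_bounded s f -> ball_bounded s g -> ball_bounded s (fun y => f y + g y).
Proof.
move=> [mf [C fC]] [mg [D gD]]; split; first exact: measurable_funD.
by exists (C + D) => y ys; rewrite (le_trans (ler_normD _ _))// lerD ?fC ?gD.
Qed.

Lemma ball_boundedM d s (f g : d.-tuple R -> R) :
  ball_bounded s f -> ball_bounded s g -> ball_bounded s (fun y => f y * g y).
Proof.
move=> [mf [C fC]] [mg [D gD]]; split; first exact: measurable_funM.
by exists (C * D) => y ys; rewrite normrM ler_pM ?fC ?gD.
Qed.

Lemma ball_boundedN d s (f : d.-tuple R -> R) :
  ball_bounded s f -> ball_bounded s (fun y => - f y).
Proof.
move=> [mf [C fC]]; split; first exact: measurableT_comp.
by exists C => y ys; rewrite normrN fC.
Qed.

Lemma ball_bounded_tnth d s i : ball_bounded s (fun y : d.-tuple R => tnth y i).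
Proof.
split; first exact: measurable_tnth.
by exists (1 + s) => y; exact: norm_tnth_le.
Qed.

Lemma ball_boundedX d s (f : d.-tuple R -> R) k :
  ball_bounded s f -> ball_bounded s (fun y => f y ^+ k).
Proof.
move=> bf; elim: k => [|k IHk]; first exact: ball_bounded_cst.
by under eq_fun do rewrite exprS; exact: ball_boundedM.
Qed.

Lemma ball_bounded_prod d s I (r : seq I) (P : pred I) (f : I -> d.-tuple R -> R) :
  (forall i, ball_bounded s (f i)) ->
  ball_bounded s (fun y => \prod_(i <- r | P i) f i y).
Proof.
move=> bf; elim: r => [|i r IHr].
  by under eq_fun do rewrite big_nil; exact: ball_bounded_cst.
under eq_fun do rewrite big_cons.
by case: (P i) => //; exact: ball_boundedM.
Qed.

Lemma ball_bounded_sqnorm d s : ball_bounded s (@sqnorm R d).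
Proof.
split; first exact: measurable_sqnorm.
exists s => y /ltW; rewrite ger0_norm// sumr_ge0// => i _; exact: sqr_ge0.
Qed.

Lemma ball_bounded_mon d s (m : 'I_d -> nat) : ball_bounded s (mon m).
Proof.
by apply: ball_bounded_prod => i; apply: ball_boundedX; exact: ball_bounded_tnth.
Qed.

Lemma ball_bounded_dmon d s (m : 'I_d -> nat) j : ball_bounded s (dmon m j).
Proof.
apply: ball_boundedM; last first.
  by apply: ball_bounded_prod => i; apply: ball_boundedX; exact: ball_bounded_tnth.
apply: ball_boundedM; first exact: ball_bounded_cst.
by apply: ball_boundedX; exact: ball_bounded_tnth.
Qed.

Lemma integrable_divergence_mon d a s (m : 'I_d -> nat) (j : 'I_d) : -1 < a ->
  (leb d).-integrable setT
    (fun y => ((dmon m j y * (s - sqnorm y) - 2 * (a + 1) * tnth y j * mon m y)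
               * pospow a (s - sqnorm y))%:E).
Proof.
move=> a1; apply: ball_bounded_integrable => //; apply: ball_boundedD.
  apply: ball_boundedM; first exact: ball_bounded_dmon.
  apply: ball_boundedD; first exact: ball_bounded_cst.
  by apply: ball_boundedN; exact: ball_bounded_sqnorm.
apply: ball_boundedN; apply: ball_boundedM; last exact: ball_bounded_mon.
by apply: ball_boundedM; [exact: ball_bounded_cst|exact: ball_bounded_tnth].
Qed.

(** Induction on [d] for every squared radius [s], since slicing the ball changes its radius. The
    order of integration depends on whether [j] is the first coordinate. *)
Lemma integral_divergence_mon d a s (m : 'I_d -> nat) (j : 'I_d) : -1 < a ->
  (\int[leb d]_y ((dmon m j y * (s - sqnorm y) - 2 * (a + 1) * tnth y j * mon m y)
     * pospow a (s - sqnorm y))%:E = 0)%E.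
Proof.
move=> a1; elim: d m j s => [m []//|d IHd] m j s.
have fi := integrable_divergence_mon s m j a1.
rewrite (integral_tupleS fi).
case: (unliftP ord0 j) fi => [j' ->|->] fi.
  (* Here [j] is a later coordinate: on the slice at height [t] the induction hypothesis applies
     with squared radius s - t^2. *)
  rewrite -(integral12_prod_meas1 (integrable_tupleS fi)).
  apply: integral0_eq => t _; rewrite /fubini_F /=.
  rewrite -[RHS](mule0 (t ^+ m ord0)%:E) -(IHd (m \o lift ord0) j' (s - t ^+ 2)).
  rewrite -integralZl//; last exact: integrable_divergence_mon.
  apply: eq_integral => y _; rewrite -EFinM; congr EFin.
  rewrite dmon_consS mon_cons sqnorm_cons/= opprD addrA.
  rewrite (_ : tnth _ (lift _ _) = tnth y j'); first by ring.
  by rewrite tnthS; congr tnth; exact: val_inj.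
(* Here [j] is the first coordinate: the others are frozen and the one-dimensional identity applies
   with squared radius s - |y|^2. *)
rewrite -(integral21_prod_meas1 (integrable_tupleS fi)).
apply: integral0_eq => y _; rewrite /fubini_G /=.
have [gi g0] := integral_derivative_pospow_sphere (s - sqnorm y) (m ord0) a1.
rewrite -[RHS](mule0 (mon (m \o lift ord0) y)%:E) -g0 -integralZl//.
apply: eq_integral => t _; rewrite -EFinM; congr EFin.
rewrite dmon_cons0 mon_cons sqnorm_cons/= tnth0 (exprS t (m ord0)).
rewrite (_ : s - _ = s - sqnorm y - t ^+ 2); last by rewrite opprD addrA addrAC.
move: (pospow _ _) (t ^+ (m ord0).-1) (t ^+ m ord0) => p u v /=; ring.
Qed.

End tuple_integral.

(** * The weighted integral as a functional on complex polynomials *)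

Lemma conjC_lin (C : numClosedFieldType) (c x y : C) :
  (c * x + y)^*%R = c^*%R * x^*%R + y^*%R.
Proof. by rewrite rmorphD rmorphM. Qed.

Section ball_functional.
Local Open Scope classical_set_scope.
Local Open Scope ring_scope.
Local Open Scope complex_scope.
Variables (R : realType) (d : nat) (alpha : R).
Hypothesis alpha_gtN1 : -1 < alpha.
Implicit Types (p q : {mpoly R[i][d]}) (g h : d.-tuple R -> R[i]).
Notation leb := (lebesgue_tuple R d).

Definition weight (y : d.-tuple R) : R := pospow alpha (1 - sqnorm y).

Definition ball_boundedC g :=
  ball_bounded 1 (fun y => complex.Re (g y)) /\ ball_bounded 1 (fun y => complex.Im (g y)).

Definition wint g : R[i] :=
  integral_ball (fun x => g x * ((1 - sqnorm x) `^ alpha)%:C).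

(** Inside the ball [weight] is the power, outside it is 0, so the domain can be the whole space. *)
Lemma Rintegral_unit_ball (f : d.-tuple R -> R) :
  \int[leb]_(x in @unit_ball R d) (f x * (1 - sqnorm x) `^ alpha)
  = \int[leb]_x (f x * weight x).
Proof.
rewrite Rintegral_mkcond; apply: eq_Rintegral => y _.
rewrite patchE /weight /pospow subr_gt0.
case: ifPn => [/set_mem /= ->//|/negP ny].
by case: ifPn => [hy|_]; [case: ny; exact: mem_set|rewrite mulr0].
Qed.

Lemma wintE g : wint g = (\int[leb]_x (complex.Re (g x) * weight x))
   +i* (\int[leb]_x (complex.Im (g x) * weight x)).
Proof.
rewrite /wint /integral_ball -!Rintegral_unit_ball.
by congr (_ +i* _); apply: eq_Rintegral => y _; case: (g y) => a b /=; ring.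
Qed.

Lemma integrable_weight (f : d.-tuple R -> R) : ball_bounded 1 f ->
  leb.-integrable setT (EFin \o (fun y => f y * weight y)).
Proof. exact: ball_bounded_integrable. Qed.

(** The shape of the real and imaginary parts of [c * g + h] for complex [c]. *)
Lemma Rintegral_weight_lin (k l : R) (u v w : d.-tuple R -> R) :
  ball_bounded 1 u -> ball_bounded 1 v -> ball_bounded 1 w ->
  \int[leb]_x ((k * u x + l * v x + w x) * weight x)
    = k * (\int[leb]_x (u x * weight x)) + l * (\int[leb]_x (v x * weight x))
     + \int[leb]_x (w x * weight x).
Proof.
move=> bu bv bw.
have Z (c : R) (f : d.-tuple R -> R) : ball_bounded 1 f ->
    ball_bounded 1 (fun y => c * f y).
  by move=> bf; apply: (ball_boundedM _ bf); exact: ball_bounded_cst.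
rewrite -!RintegralZl//; try exact: integrable_weight.
transitivity (\int[leb]_x (k * u x * weight x + l * v x * weight x + w x * weight x)).
  by apply: eq_Rintegral => y _; ring.
have iu := integrable_weight (Z k _ bu); have iv := integrable_weight (Z l _ bv).
rewrite RintegralD//; last exact: integrable_weight.
  rewrite RintegralD//.
  by congr (_ + _ + _); apply: eq_Rintegral => y _; rewrite mulrA.
exact: (integrableD measurableT iu iv).
Qed.

Lemma wint_lin c g h : ball_boundedC g -> ball_boundedC h ->
  wint (fun y => c * g y + h y) = c * wint g + wint h.
Proof.
move=> [gr gi] [hr hi]; case: c => a b; rewrite !wintE /=.
apply/eqP; rewrite eq_complex /= -mulNr -!Rintegral_weight_lin//.
apply/andP; split; apply/eqP; apply: eq_Rintegral => y _.
  by case: (g y) => ? ?; case: (h y) => ? ? /=; ring.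
by case: (g y) => ? ?; case: (h y) => ? ? /=; ring.
Qed.

Lemma wint_real (f : d.-tuple R -> R) :
  wint (fun y => (f y)%:C) = (\int[leb]_x (f x * weight x))%:C.
Proof.
rewrite wintE /=; congr (_ +i* _).
rewrite (@eq_Rintegral _ _ _ _ _ (fun=> 0)) ?Rintegral_cst ?mul0r//.
by move=> y _; rewrite mul0r.
Qed.

Lemma ball_boundedC_lin c g h : ball_boundedC g -> ball_boundedC h ->
  ball_boundedC (fun y => c * g y + h y).
Proof.
case: c => a b [gr gi] [hr hi].
have Z (k l : R) u v w : ball_bounded 1 u -> ball_bounded 1 v -> ball_bounded 1 w ->
    @ball_bounded R d 1 (fun y => k * u y + l * v y + w y).
  move=> bu bv bw; apply: ball_boundedD => //.
  by apply: ball_boundedD; apply: ball_boundedM => //; exact: ball_bounded_cst.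
split.
  have := Z a (- b) _ _ _ gr gi hr.
  rewrite (_ : (fun _ => _) = (fun y => complex.Re ((a +i* b) * g y + h y)))//.
  by apply/funext => y; case: (g y) => ? ?; case: (h y) => ? ? /=; ring.
have := Z a b _ _ _ gi gr hi.
rewrite (_ : (fun _ => _) = (fun y => complex.Im ((a +i* b) * g y + h y)))//.
by apply/funext => y; case: (g y) => ? ?; case: (h y) => ? ? /=; ring.
Qed.

Lemma ball_boundedC_real (f : d.-tuple R -> R) : ball_bounded 1 f ->
  ball_boundedC (fun y => (f y)%:C).
Proof. by move=> bf; split => //=; exact: ball_bounded_cst. Qed.

Lemma mpfun_mon (m : 'X_{1..d}) (y : d.-tuple R) :
  mpfun 'X_[m] y = (mon m y)%:C.
Proof. by rewrite /mpfun mevalX rmorph_prod; apply: eq_bigr => i _; rewrite rmorphXn. Qed.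

Lemma mpfun_lin c p q : mpfun (c *: p + q) = (fun y => c * mpfun p y + mpfun q y).
Proof. by apply/funext => y; rewrite /mpfun mevalD mevalZ. Qed.

Lemma mpfun0 : mpfun (0 : {mpoly R[i][d]}) = (fun=> 0).
Proof. by apply/funext => y; rewrite /mpfun meval0. Qed.

Lemma ball_boundedC_mpfun p : ball_boundedC (mpfun p).
Proof.
elim/mpoly_lin_ind: p => [|c m p IHp].
  by rewrite mpfun0; apply: (@ball_boundedC_real (fun=> 0)); exact: ball_bounded_cst.
rewrite mpfun_lin; apply: ball_boundedC_lin => //.
rewrite (_ : mpfun _ = fun y => (mon m y)%:C); last exact/funext/mpfun_mon.
by apply: ball_boundedC_real; exact: ball_bounded_mon.
Qed.

Lemma mpfunM p q y : mpfun (p * q) y = mpfun p y * mpfun q y.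
Proof. exact: mevalM. Qed.

Lemma mpfunB p q y : mpfun (p - q) y = mpfun p y - mpfun q y.
Proof. exact: mevalB. Qed.

Lemma mpfun1 y : mpfun (1 : {mpoly R[i][d]}) y = 1.
Proof. exact: meval1. Qed.

Lemma mpfunXU i y : mpfun ('X_i : {mpoly R[i][d]}) y = (tnth y i)%:C.
Proof. exact: mevalXU. Qed.

Definition ball_int p : R[i] := wint (mpfun p).

Lemma ball_int_lin c p q : ball_int (c *: p + q) = c * ball_int p + ball_int q.
Proof. by rewrite /ball_int mpfun_lin wint_lin//; exact: ball_boundedC_mpfun. Qed.

Lemma conjC_complex (a b : R) : (a +i* b)^*%R = a -i* b.
Proof. by []. Qed.

Lemma complex_conjC_eq (z w : R[i]) :
  complex.Re z = complex.Re w -> complex.Im z = - complex.Im w -> z = w^*%R.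
Proof. by case: z w => [a b] [a' b'] /= -> ->. Qed.

Lemma ReJ (z : R[i]) : complex.Re z^*%R = complex.Re z.
Proof. by case: z. Qed.

Lemma ImJ (z : R[i]) : complex.Im z^*%R = - complex.Im z.
Proof. by case: z. Qed.

Lemma conjC_realC (a : R) : (a%:C)^*%R = a%:C.
Proof. by rewrite conjC_complex oppr0. Qed.

Lemma mpfun_mconj p y : mpfun (mconj p) y = (mpfun p y)^*%R.
Proof.
elim/mpoly_lin_ind: p => [|c m p IHp]; first by rewrite mconj0 mpfun0 /= rmorph0.
rewrite mconjD mconjZ mconjX !mpfun_lin IHp conjC_lin.
by congr (_ * _ + _); rewrite mpfun_mon conjC_realC.
Qed.

Lemma innerpE p q : innerp alpha p q = ball_int (p * mconj q).
Proof.
rewrite /innerp /inner /ball_int /wint; congr integral_ball; apply/funext => y.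
by rewrite -mpfun_mconj /mpfun mevalM.
Qed.

Lemma ball_int_mconj p : ball_int (mconj p) = (ball_int p)^*%R.
Proof.
apply: complex_conjC_eq; rewrite /ball_int !wintE /=.
  by apply: eq_Rintegral => y _; rewrite mpfun_mconj; rewrite ReJ.
rewrite -mulN1r -RintegralZl//; last first.
  by apply: integrable_weight; case: (ball_boundedC_mpfun p).
by apply: eq_Rintegral => y _; rewrite mpfun_mconj; rewrite ImJ; ring.
Qed.

Lemma mpfun_sqnormX y : mpfun (sqnormX R d) y = (sqnorm y)%:C.
Proof.
rewrite /mpfun raddf_sum rmorph_sum /=; apply: eq_bigr => i _.
by rewrite rmorphXn /= mevalXU rmorphXn.
Qed.

Lemma mpfun_mderiv_mon j (m : 'X_{1..d}) (y : d.-tuple R) :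
  mpfun ('X_[m]^`M(j)) y = (dmon m j y)%:C.
Proof.
rewrite mderivX /mpfun mevalZ mevalX /dmon !rmorphM /= rmorph_nat -mulrA; congr (_ * _).
rewrite (bigD1 j)//= mnmBE mnm1E eqxx subn1 rmorphXn; congr (_ * _).
rewrite rmorph_prod; apply: eq_bigr => i ij.
by rewrite mnmBE mnm1E eq_sym (negPf ij) subn0 rmorphXn.
Qed.

(** Identity (1) for the ball. The difference [F] of the two sides is linear, so monomials suffice,
    and there [integral_divergence_mon] applies with [s = 1]. *)
Lemma ball_int_div j p :
  ball_int ((1 - sqnormX R d) * p^`M(j)) = (2 * (alpha + 1))%:C * ball_int ('X_j * p).
Proof.
pose F q := (- (2 * (alpha + 1))%:C) *: ('X_j * q) + (1 - sqnormX R d) * q^`M(j).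
suff F0 : ball_int (F p) = 0.
  by apply/eqP; rewrite -subr_eq0 addrC -mulNr -ball_int_lin -/(F p) F0.
elim/mpoly_lin_ind: p => [|c m p IHp].
  rewrite /F mderiv0 !mulr0 scaler0 addr0.
  rewrite /ball_int mpfun0 (wint_real (fun=> 0)) /Rintegral integral0_eq// => y _.
  by rewrite mul0r.
have -> : F (c *: 'X_[m] + p) = c *: F 'X_[m] + F p.
  rewrite /F mderivD mderivZ !mulrDr !scalerDr -!scalerAr !scalerA [c * _]mulrC.
  by rewrite -!addrA; congr (_ + _); rewrite addrCA.
rewrite ball_int_lin IHp addr0.
rewrite /ball_int.
have -> : mpfun (F 'X_[m]) = fun y =>
   (dmon m j y * (1 - sqnorm y) - 2 * (alpha + 1) * tnth y j * mon m y)%:C.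
  apply/funext => y; rewrite mpfun_lin !mpfunM mpfunB mpfun1 mpfunXU.
  rewrite mpfun_sqnormX mpfun_mderiv_mon mpfun_mon.
  rewrite !(rmorphM, rmorphB, rmorph1) /=. ring.
rewrite wint_real /Rintegral.
under eq_integral do rewrite /weight.
by rewrite integral_divergence_mon// mulr0.
Qed.

(** * Positivity of the weighted integral *)

Definition sqnormc (z : R[i]) : R := complex.Re z ^+ 2 + complex.Im z ^+ 2.

Lemma mulC_conjC (z : R[i]) : z * z^*%R = (sqnormc z)%:C.
Proof. by rewrite -normCK -add_Re2_Im2. Qed.

Lemma sqnormc_ge0 z : 0 <= sqnormc z.
Proof. by rewrite addr_ge0// sqr_ge0. Qed.

Lemma sqnormc_eq0 z : (sqnormc z == 0) = (z == 0).
Proof. by case: z => a b; rewrite eq_complex paddr_eq0 ?sqr_ge0// !sqrf_eq0. Qed.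

Lemma ball_int_mulJ p :
  ball_int (p * mconj p) = (\int[leb]_y (sqnormc (mpfun p y) * weight y))%:C.
Proof.
rewrite -wint_real /ball_int; congr wint; apply/funext => y.
by rewrite -mulC_conjC -mpfun_mconj /mpfun mevalM.
Qed.

Lemma ball_int_mulJ_ge0 p : 0 <= ball_int (p * mconj p).
Proof.
rewrite ball_int_mulJ ler0c; apply: Rintegral_ge0 => y _.
by rewrite mulr_ge0 ?sqnormc_ge0 ?pospow_ge0.
Qed.

Definition origin : d.-tuple R := [tuple 0 | _ < d].

Lemma mpfun_origin p : mpfun p origin = p@_0.
Proof.
elim/mpoly_lin_ind: p => [|c m p IHp]; first by rewrite mpfun0 mcoeff0.
rewrite mpfun_lin IHp mcoeffD mcoeffZ mcoeffX mpfun_mon; congr (_ * _ + _).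
have [->|m0] := eqVneq m 0%MM.
  by rewrite /mon big1// => i _; rewrite mnm0E.
case: (pickP (fun i => m i != 0%N)) => [i mi|mm]; last first.
  by case/eqP: m0; apply/mnmP => i; rewrite mnm0E; apply/eqP/negbFE/mm.
by rewrite /mon (bigD1 i)//= tnth_mktuple expr0n (negPf mi) mul0r.
Qed.

(** A nonconstant monomial has one factor of modulus at most [e] and the others at most 1. *)
Lemma mon_near_origin (m : 'I_d -> nat) (e : R) (y : d.-tuple R) : 0 <= e <= 1 ->
  (forall i, `|tnth y i| <= e) -> `|mon m y - mon m origin| <= e.
Proof.
move=> /andP[e0 e1] ye; have [m0|/existsP[i mi]] := boolP [forall i, m i == 0%N].
  rewrite /mon !big1 ?subrr ?normr0// => i _;
  by move/forallP: m0 => /(_ i)/eqP ->.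
rewrite [mon m origin](_ : _ = 0) ?subr0; last first.
  by rewrite /mon (bigD1 i)//= tnth_mktuple expr0n (negPf mi) mul0r.
rewrite /mon (bigD1 i)//= normrM normrX normr_prod -[leRHS]mulr1.
apply: ler_pM => //; first exact: prodr_ge0.
  rewrite -(prednK (n := m i)) ?lt0n// exprS -[leRHS]mulr1; apply: ler_pM => //.
  by apply: exprn_ile1 => //; exact: le_trans e1.
apply: (@le_trans _ _ (\prod_(i0 < d | i0 != i) 1)); last by rewrite big1.
apply: ler_prod => k _; rewrite normr_ge0 normrX/= exprn_ile1//.
exact: le_trans e1.
Qed.

(** Continuity at the origin with a linear modulus; the constant built is the sum of the moduli of
    the coefficients. *)
Lemma mpfun_near_origin p : exists2 C : R, 0 <= C &
  forall (e : R) (y : d.-tuple R), 0 <= e <= 1 -> (forall i, `|tnth y i| <= e) ->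
    `|mpfun p y - mpfun p origin| <= (e * C)%:C.
Proof.
elim/mpoly_lin_ind: p => [|c m p [C C0 IHp]].
  by exists 0 => // e y _ _; rewrite mpfun0 subrr normr0 mulr0.
exists (Num.sqrt (complex.Re c ^+ 2 + complex.Im c ^+ 2) + C).
  by rewrite addr_ge0// sqrtr_ge0.
move=> e y e01 ye; rewrite !mpfun_lin !mpfun_mon opprD addrACA -mulrBr.
rewrite [(e * _)%:C](_ : _ = (e * Num.sqrt (complex.Re c ^+ 2 + complex.Im c ^+ 2))%:C
  + (e * C)%:C); last first.
  by rewrite -rmorphD -mulrDr.
rewrite (le_trans (ler_normD _ _))// lerD ?IHp//.
rewrite normrM normc_def mulrC rmorphM ler_wpM2r ?ler0c ?sqrtr_ge0//.
rewrite -rmorphB /= normc_def /= expr0n addr0 sqrtr_sqr lecR.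
exact: mon_near_origin.
Qed.

Lemma mpfun_neq0_near_origin p : mpfun p origin != 0 ->
  exists2 e : R, 0 < e <= 1 & forall y, (forall i, `|tnth y i| <= e) ->
    sqnorm y < 1 /\ mpfun p y != 0.
Proof.
move=> p0; have [C C0 pC] := mpfun_near_origin p.
pose c0 := Num.sqrt (complex.Re (mpfun p origin) ^+ 2 + complex.Im (mpfun p origin) ^+ 2).
have c0E : `|mpfun p origin| = c0%:C by rewrite normc_def.
have c0_gt0 : 0 < c0 by rewrite -(ltcR 0) -c0E normr_gt0.
(* The three summands give e <= 1, e d < 1, which puts the box inside the ball, and e C < c0, which
   keeps [p] away from 0. *)
pose e := (2 + d%:R + C / c0)^-1.
have D0 : 0 <= d%:R + C / c0 by rewrite addr_ge0// divr_ge0// ltW.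
have e0 : 0 < e by rewrite invr_gt0 -addrA; lra.
have e1 : e <= 1 by rewrite invf_le1 -addrA; lra.
have eE : e * (2 + d%:R + C / c0) = 1 by rewrite mulVf// gt_eqF// -invr_gt0.
have eC : e * C < c0.
  rewrite -(ltr_pM2r (x := c0^-1)) ?invr_gt0// divff ?gt_eqF// -mulrA -eE.
  by rewrite ltr_pM2l// ltrDr; have := ler0n R d; lra.
have ed : e * d%:R < 1.
  by rewrite -[ltRHS]eE ltr_pM2l//; have := divr_ge0 C0 (ltW c0_gt0); lra.
exists e; first by rewrite e0.
move=> y ye; split.
  apply: le_lt_trans ed; rewrite /sqnorm.
  apply: (@le_trans _ _ (\sum_(i < d) e)); last by rewrite sumr_const card_ord mulr_natr.
  apply: ler_sum => i _; rewrite -real_normK ?num_real// expr2.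
  by rewrite -[leRHS]mulr1 ler_pM// (le_trans (ye i)).
have h := pC e y (introT andP (conj (ltW e0) e1)) ye.
apply/eqP => py; move: h; rewrite py sub0r normrN c0E lecR.
by rewrite leNgt eC.
Qed.

(** Were the integral 0, the integrand would vanish almost everywhere; but it is positive on a box
    around the origin, whose volume is positive. *)
Lemma ball_int_mulJ_neq0 p : mpfun p origin != 0 -> ball_int (p * mconj p) != 0.
Proof.
move=> /mpfun_neq0_near_origin[e /andP[e0 _] ye].
rewrite ball_int_mulJ; apply/negP => /eqP []; rewrite /Rintegral => int0.
pose f y := (sqnormc (mpfun p y) * weight y)%:E.
have fi : leb.-integrable setT f.
  have [br bi] := ball_boundedC_mpfun p.
  apply: (@integrable_weight (fun y => sqnormc (mpfun p y))).
  by apply: ball_boundedD; exact: ball_boundedX.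
have {}int0 : (\int[leb]_y `|f y| = 0)%E.
  rewrite (eq_integral f); last first.
    by move=> y _; rewrite gee0_abs// lee_fin mulr_ge0 ?sqnormc_ge0 ?pospow_ge0.
  by rewrite -[LHS]fineK ?int0// integrable_fin_num.
have /integrableP[mf _] := fi.
have /(ae_eq_integral_abs _ measurableT mf).1 [A [mA A0 fA]] := int0.
pose B : set (d.-tuple R) := [set y | forall i, `[- e, e]%classic (tnth y i)].
have mB : measurable B.
  rewrite [X in measurable X](_ : _ = \bigcap_(i in [set: 'I_d])
    ((fun y : d.-tuple R => tnth y i) @^-1` `[- e, e]%classic)).
    apply: fin_bigcap_measurable => // i _.
    by rewrite -[X in measurable X]setTI; exact: measurable_tnth.
  by apply/seteqP; split => y H i; [move=> _; exact: H|exact: (H i)].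
have BA : B `<=` A.
  move=> y By; apply: fA => /= /(_ I) [] /eqP; rewrite mulf_eq0 sqnormc_eq0.
  have [|y1 py] := ye y; first by move=> i; have := By i; rewrite /= in_itv /= ler_norml.
  by rewrite (negPf py) /weight /pospow subr_gt0 y1 gt_eqF// powR_gt0// subr_gt0.
have : (leb B <= leb A)%E by apply: le_measure => //; rewrite inE.
rewrite A0 (@lebesgue_tuple_box R d (fun=> `[- e, e]%classic))// leNgt => /negP; apply.
elim/big_ind : _ => //; first by move=> x y x0 y0; rewrite mule_gt0.
move=> i _; rewrite lebesgue_measure_itv /= lte_fin ifT.
  by rewrite -EFinB lte_fin; lra.
by lra.
Qed.

End ball_functional.

(** * Transfer to the operators and products of the statement *)

Local Open Scope complex_scope.

Lemma Lop_ballop (R : realType) (d : nat) (beta : R) (q : {mpoly R[i][d]}) :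
  Lop beta q = ballop (2 * (beta + 1))%:C q.
Proof. reflexivity. Qed.

Lemma innerp1 (R : realType) (d : nat) (alpha : R) (p : {mpoly R[i][d]}) :
  innerp alpha p 1 = ball_int alpha p.
Proof. by rewrite innerpE mconj1 mulr1. Qed.

Lemma inner1_sobolev (R : realType) (d : nat) (alpha : R) (p q : {mpoly R[i][d]}) :
  inner1 alpha p q = sobolev (@ball_int R d alpha) p q.
Proof.
rewrite /inner1 /sobolev /calpha !innerp1; congr (_ + _).
by apply: eq_bigr => i _; rewrite innerpE.
Qed.

Theorem theorem3p14 (R : realType) (d : nat) (hd : (0 < d)%N)
    (alpha : R) (halpha : -1 < alpha) (n : nat) (p : {mpoly R[i][d]})
    (hp : V1 alpha n p) :
  Ltilde alpha p = (lambda_tilde d alpha n)%:C *: p.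
Proof.
case: hp => pn pq.
(* Lowering [k] by 2 is passing from alpha to alpha - 1; both sides are 2 alpha. *)
have k2 : (2 * (alpha + 1))%:C - 2 = (2 * (alpha - 1 + 1))%:C :> R[i].
  by rewrite subrK mulrDr mulr1 rmorphD /= rmorph_nat addrK.
have -> : Ltilde alpha p = ballop_corr (@ball_int R d alpha) (2 * (alpha + 1))%:C p.
  by rewrite /Ltilde /ballop_corr /proj0 /calpha !innerp1 k2 Lop_ballop.
have -> : (lambda_tilde d alpha n)%:C = eigval d ((2 * (alpha + 1))%:C - 2) n :> R[i].
  rewrite /eigval /lambda_tilde k2 subrK.
  by rewrite !(rmorphM, rmorphD, rmorphN, rmorph_nat).
apply: sobolev_orthogonal_eigen.
- exact: ball_int_lin.
- by rewrite ltcR mulr_gt0// -ltrBlDr sub0r.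
- exact: ball_int_div.
- exact: ball_int_mconj.
- exact: ball_int_mulJ_ge0.
- by move=> q q0; apply: ball_int_mulJ_neq0 => //; rewrite mpfun_origin.
- by move: pn; rewrite /Pi_ /= -PoszD lez_nat addn1.
(* Degree at most n - 1 reads [msize q <= n], which for [n = 0] leaves only the zero polynomial. *)
- move=> q qn; rewrite -inner1_sobolev; apply: pq.
  by rewrite /Pi_ /= subrK lez_nat.
Qed.
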